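(* For every $w\in\tilde S_n$ ($n>2$), the affine Stanley symmetric function $\tilde F_w$ is a symmetric function.
   Context: $\tilde S_n$ is the affine symmetric group with generators $s_0,\ldots,s_{n-1}$ (indices mod $n$), relations $s_i^2=1$, $s_is_{i+1}s_i=s_{i+1}s_is_{i+1}$, $s_is_j=s_js_i$ for $i-j\not\equiv0,\pm1$; $\ell$ is the length function. A word in $\mathbb Z/n\mathbb Z$ is cyclically decreasing if each letter occurs at most once and whenever $i,i+1$ both occur, $i+1$ precedes $i$; an element is cyclically decreasing if it has a cyclically decreasing reduced word (the identity included). $\tilde F_w=\sum x_1^{\ell(v_1)}x_2^{\ell(v_2)}\cdots$, summed over infinite sequences $(v_1,v_2,\ldots)$ of cyclically decreasing elements, all but finitely many the identity, with $v_1v_2\cdots=w$ and $\sum\ell(v_i)=\ell(w)$. *)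

(* Defs.v *)
From HB Require Import structures.
From mathcomp Require Import all_boot.
From Stdlib Require List.

Set Implicit Arguments.
Unset Strict Implicit.
Unset Printing Implicit Defensive.

(* Generators s_0,...,s_{n-1} are indexed by 'I_n; a word is a seq 'I_n,
   read as the product s_{a_1} s_{a_2} ... s_{a_k}. *)

Definition succ_mod (n : nat) (i : 'I_n) : nat := (i.+1 %% n).

Definition adjacent (n : nat) (i j : 'I_n) : bool :=
  (nat_of_ord j == succ_mod i) || (nat_of_ord i == succ_mod j).

Inductive braid_rel (n : nat) : seq 'I_n -> seq 'I_n -> Prop :=
| br_sq (i : 'I_n) : braid_rel [:: i; i] [::]
| br_braid (i j : 'I_n) : nat_of_ord j = succ_mod i ->
    braid_rel [:: i; j; i] [:: j; i; j]
| br_comm (i j : 'I_n) : i != j -> ~~ adjacent i j ->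
    braid_rel [:: i; j] [:: j; i].

Inductive weq (n : nat) : seq 'I_n -> seq 'I_n -> Prop :=
| weq_refl (u : seq 'I_n) : weq u u
| weq_sym (u v : seq 'I_n) : weq u v -> weq v u
| weq_trans (u v x : seq 'I_n) : weq u v -> weq v x -> weq u x
| weq_step (a b l r : seq 'I_n) : braid_rel a b -> weq (l ++ a ++ r) (l ++ b ++ r).

Definition affS (n : nat) : Type :=
  {P : seq 'I_n -> Prop | exists u, forall x, P x <-> weq u x}.

Definition inw (n : nat) (x : affS n) (u : seq 'I_n) : Prop := proj1_sig x u.

Definition cls (n : nat) (u : seq 'I_n) : affS n :=
  exist (fun P => exists u0, forall x, P x <-> weq u0 x) (weq u)
        (ex_intro _ u (fun x => iff_refl (weq u x))).

Definition one (n : nat) : affS n := cls (n:=n) [::].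

Definition reduced (n : nat) (u : seq 'I_n) : Prop :=
  forall u', weq u u' -> size u <= size u'.

Definition length_is (n : nat) (x : affS n) (k : nat) : Prop :=
  exists u, inw x u /\ reduced u /\ size u = k.

Definition cyc_dec_word (n : nat) (u : seq 'I_n) : bool :=
  uniq u &&
  all (fun i => all (fun j => (nat_of_ord j == succ_mod i) ==> (index j u < index i u)) u) u.

Definition cyc_dec (n : nat) (x : affS n) : Prop :=
  exists u, inw x u /\ reduced u /\ cyc_dec_word u.

(* (v_1, v_2, ...) (indexed from 0) is a factorization of w contributing to
   the monomial x^alpha = x_1^(alpha 0) x_2^(alpha 1) ... : each v_i is
   cyclically decreasing with ell(v_i) = alpha i, all but finitely many v_i are
   the identity, v_1 v_2 ... = w and sum ell(v_i) = ell(w). *)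
Definition factorization (n : nat) (w : affS n) (alpha : nat -> nat)
    (v : nat -> affS n) : Prop :=
  (forall i, cyc_dec (v i)) /\
  (forall i, length_is (v i) (alpha i)) /\
  exists N : nat,
    (forall i, N <= i -> v i = one n) /\
    (exists us : nat -> seq 'I_n,
        (forall i, inw (v i) (us i)) /\
        inw w (flatten [seq us i | i <- iota 0 N])) /\
    (exists k, length_is w k /\ \sum_(i < N) alpha i = k).

Definition card_is (T : Type) (S : T -> Prop) (c : nat) : Prop :=
  exists l : list T, List.NoDup l /\ size l = c /\ forall x, S x <-> List.In x l.

Definition Ftilde_coeff (n : nat) (w : affS n) (alpha : nat -> nat) (c : nat) : Prop :=
  card_is (factorization w alpha) c.

(* A formal power series in x_1, x_2, ..., given by its coefficient relation
   (alpha i = exponent of x_{i+1}), is a symmetric function: coefficients are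
   well defined, it has bounded degree, and it is invariant under every
   permutation of the variables. *)
Definition is_symmetric_function (coef : (nat -> nat) -> nat -> Prop) : Prop :=
  (forall alpha, exists! c, coef alpha c) /\
  (exists d, forall alpha c, coef alpha c -> c <> 0 ->
      exists N, (forall i, N <= i -> alpha i = 0) /\ \sum_(i < N) alpha i <= d) /\
  (forall sigma : nat -> nat, bijective sigma ->
      forall alpha c, coef alpha c -> coef (fun i => alpha (sigma i)) c).

(* Main.v *)
Require Import Defs.
From mathcomp Require Import all_boot order ssralg ssrnum ssrint intdiv boolp.
From mathcomp Require Import zify.

Set Implicit Arguments.
Unset Strict Implicit.
Unset Printing Implicit Defensive.

(** Cyclically decreasing elements correspond to proper subsets A of Z/n through
    d_A, the product of the letters of A with i + 1 before i. Since only finitely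
    many variables matter at a time, it suffices that the generators h_a, the sum
    of the d_A with |A| = a, commute on reduced products: the number of (A, B)
    with |A| = a, |B| = b and d_A d_B a given reduced product is symmetric in a, b.

    Label i in Z/n by c, a, b or e according as both, only the first, only the
    second or none of "i in A", "i + 1 in B" holds, and delete the c's. Reading
    cyclically, a factor "ba" makes d_A d_B non-reduced, and exchanging "be" with
    "ea" does not change the product, because the element D = s_k ... s_1
    satisfies D s_(j+1) = s_j D. If there is no "ba", the cyclic word is a union
    of blocks b^p e a^q, and replacing every block by b^q e a^p is an involution
    that exchanges |A| and |B| and keeps d_A d_B. To avoid choosing a place to cut
    the cyclic word, each word is counted once for each start of a block: the
    number of block starts is the number m of e's, hence m times the count of
    pairs is symmetric, and m > 0 because A and B are proper. *)

(** * Words modulo the relations; cyclically decreasing words and subsets of Z/n *)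

Section Words.
Variable n : nat.
Implicit Types (i j : 'I_n) (u v x y l r : seq 'I_n).

Lemma weq_cat u u' v v' : weq u u' -> weq v v' -> weq (u ++ v) (u' ++ v').
Proof.
have ctx a b l r : weq a b -> weq (l ++ a ++ r) (l ++ b ++ r).
  elim=> {a b} [a|a b _|a b c _ IH1 _ IH2|a b l' r' ab].
  - exact: weq_refl.
  - exact: weq_sym.
  - exact: weq_trans IH1 IH2.
  - have := weq_step (l ++ l') (r' ++ r) ab; by rewrite !catA -!catA.
move=> uu vv; apply: (weq_trans (v := u' ++ v)).
  exact: (ctx _ _ [::] v uu).
by have := ctx _ _ u' [::] vv; rewrite !cats0.
Qed.

Lemma weq_catl l u v : weq u v -> weq (l ++ u) (l ++ v).
Proof. exact/weq_cat/weq_refl. Qed.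

Lemma weq_catr r u v : weq u v -> weq (u ++ r) (v ++ r).
Proof. by move=> uv; apply: weq_cat uv (weq_refl r). Qed.

Lemma reduced_factor l u r : reduced (l ++ u ++ r) -> reduced u.
Proof.
move=> red u' uu'; have := red _ (weq_catl l (weq_catr r uu')).
by rewrite !size_cat; lia.
Qed.

Lemma reduced_weq u v : reduced u -> reduced v -> weq u v -> size u = size v.
Proof.
move=> ru rv uv; apply/eqP; rewrite eqn_leq ru // rv //; exact: weq_sym.
Qed.

Lemma adjacentE i j : adjacent i j = (j == ordS i) || (i == ordS j).
Proof. by []. Qed.

Lemma weq_move i l : (forall j, j \in l -> j != i /\ ~~ adjacent i j) ->
  weq (i :: l) (rcons l i).
Proof.
elim: l => [|j l IH] comm /=; first exact: weq_refl.
have [ji adj] := comm j (mem_head _ _).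
apply: (weq_trans (v := j :: i :: l)).
  have ij : i != j by rewrite eq_sym.
  exact: (weq_step [::] l (br_comm ij adj)).
apply: (weq_catl [:: j]); apply: IH => k kl.
by apply: comm; rewrite inE kl orbT.
Qed.

Definition nonsucc i j := j != ordS i.

Hypothesis n_gt2 : 2 < n.

Lemma ordS_neq i : ordS i != i.
Proof.
apply/eqP => /(congr1 val) /=; have := ltn_ord i.
case: (ltnP i.+1 n) => [lt _|ge lt]; first by rewrite modn_small //; lia.
have e : i.+1 = n by lia.
rewrite e modnn; lia.
Qed.

(** Fails for n = 2; it keeps apart the three residues that a braid relation moves in
    [act_braid]. *)
Lemma ordSS_neq i : ordS (ordS i) != i.
Proof.
apply/eqP => /(congr1 val) /=; have := ltn_ord i.
rewrite -[(i.+1 %% n).+1]addn1 modnDml addn1.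
case: (ltnP i.+2 n) => [lt _|ge lt]; first by rewrite modn_small //; lia.
have [e|e] : i.+2 = n \/ i.+2 = n + 1 by lia.
  rewrite e modnn; lia.
rewrite e modnDl modn_small; lia.
Qed.

(** That i + 1 precedes i means that a later letter is never the successor of an earlier one. In
    this form the condition passes to subsequences and splits over concatenations. *)
Lemma cyc_dec_wordE u : cyc_dec_word u = uniq u && pairwise nonsucc u.
Proof.
rewrite /cyc_dec_word; case uu: (uniq u) => //=.
pose x0 := Ordinal (ltnW (ltnW n_gt2)).
apply/allP/(pairwiseP x0) => [all_u a b | pw x xu].
  rewrite !inE => ha hb ab; apply/eqP => eqn.
  have := allP (all_u _ (mem_nth x0 ha)) _ (mem_nth x0 hb).
  by rewrite eqn eqxx /= -eqn !index_uniq // ltnNge ltnW.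
apply/allP => y yu; apply/implyP => /eqP yx.
have {}yx : y = ordS x by apply: val_inj.
case: ltngtP => // [lt|/eqP].
  have := pw (index x u) (index y u).
  rewrite !inE !index_mem => /(_ xu yu lt).
  by rewrite /nonsucc !nth_index // yx eqxx.
move=> /eqP/(congr1 (nth x u)); rewrite !nth_index // => xy.
by have := ordS_neq x; rewrite -yx xy eqxx.
Qed.

Lemma cdw_cons i u : cyc_dec_word (i :: u) =
  [&& i \notin u, all (nonsucc i) u & cyc_dec_word u].
Proof.
rewrite !cyc_dec_wordE /=.
by case: (_ \notin _); case: (uniq u); case: (all _ _).
Qed.

Lemma cdw_subseq u v : subseq u v -> cyc_dec_word v -> cyc_dec_word u.
Proof.
rewrite !cyc_dec_wordE => uv /andP[vu vp].
by rewrite (subseq_uniq uv) // (subseq_pairwise uv).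
Qed.

Lemma cdw_cat u v : cyc_dec_word (u ++ v) =
  [&& cyc_dec_word u, cyc_dec_word v, ~~ has (mem u) v & allrel nonsucc u v].
Proof.
rewrite !cyc_dec_wordE cat_uniq pairwise_cat.
by case: (uniq u); case: (uniq v); case: (has _ _); case: (allrel _ _ _);
  case: (pairwise _ u); case: (pairwise _ v).
Qed.

(** Let [i] be the first letter of [u]. A letter j before [i] in [v] comes after [i] in [u], so
    neither is the successor of the other; hence [i] moves to the front of [v], and induction
    applies to the rest. *)
Lemma cdw_weq u v : cyc_dec_word u -> cyc_dec_word v -> u =i v -> weq u v.
Proof.
elim: u v => [|i u IH] v.
  by move=> _ _; case: v => [_|j v /(_ j)]; [exact: weq_refl | rewrite !inE eqxx].
move=> cu; have := cu; rewrite cdw_cons => /and3P[iu iS cdu] cv uv.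
have iv : i \in v by rewrite -uv mem_head.
move: iv cv uv; case/splitPr => l r cv uv.
apply: (weq_trans (v := i :: l ++ r)).
  apply: (weq_catl [:: i]); apply: IH => //.
    by apply: cdw_subseq cv; apply: cat_subseq => //; exact: subseq_cons.
  move: cv; rewrite cyc_dec_wordE cat_uniq /= => /andP[/and3P[_ + /andP[ir _]] _].
  rewrite negb_or => /andP[il _] j.
  have := uv j; rewrite !mem_cat !inE.
  have [-> _|_ //] := eqVneq j i.
  by rewrite (negPf (il : i \notin l)) (negPf ir) (negPf iu).
rewrite -cat1s -cat_rcons catA; apply: weq_catr.
apply: weq_move => j jl.
move: cv; rewrite cdw_cat => /and4P[cdl _ hs /allrelP rel].
have ji : j != i.
  by apply: contra hs => /eqP <-; apply/hasP; exists j => //; rewrite mem_head.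
split=> //; rewrite adjacentE negb_or.
have ju : j \in u by have := uv j; rewrite inE (negPf ji) mem_cat jl.
apply/andP; split; [exact: (allP iS) | apply: rel => //; exact: mem_head].
Qed.

Lemma ordS_closed (A : {set 'I_n}) i : i \in A -> (forall j, j \in A -> ordS j \in A) ->
  A = setT.
Proof.
move=> iA AS; apply/setP => j; rewrite inE.
have it k : iter k (@ordS n) i \in A by elim: k => [|k IHk] //=; exact: AS.
have valit k : val (iter k (@ordS n) i) = (i + k) %% n.
  elim: k => [|k IHk] /=; first by rewrite addn0 modn_small.
  by rewrite IHk -[in LHS]addn1 modnDml -addnA addn1.
(* This many steps lead from [i] around the cycle to [j]; adding [n] keeps the subtraction of
   naturals exact. *)
suff -> : j = iter (j + n - i) (@ordS n) i; first exact: it.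
apply: val_inj; rewrite valit subnKC; last by have := ltn_ord i; lia.
by rewrite modnDr modn_small.
Qed.

Lemma cdw_proper u : cyc_dec_word u -> [set j in u] != setT.
Proof.
case: u => [|i u].
  move=> _; apply/eqP => /setP /(_ (Ordinal (ltnW (ltnW n_gt2)))).
  by rewrite !inE.
rewrite cdw_cons => /and3P[_ iS _]; apply/eqP => /setP /(_ (ordS i)).
rewrite !inE (negPf (ordS_neq i)) /= => Siu.
by have := allP iS _ Siu; rewrite /nonsucc eqxx.
Qed.

(** A nonempty proper set has an element j whose successor lies outside; j may be put in front of a
    word for the remaining elements. *)
Lemma cdw_exists (A : {set 'I_n}) : A != setT ->
  exists u, cyc_dec_word u && perm_eq u (enum A).
Proof.
move: {2}#|A| (leqnn #|A|) => k; elim: k A => [|k IH] A.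
  by rewrite leqn0 cards_eq0 => /eqP-> _; exists [::]; rewrite enum_set0.
move=> Ak AT; have [->|/set0Pn[i iA]] := eqVneq A set0.
  by exists [::]; rewrite enum_set0.
have [j jA SjA] : exists2 j, j \in A & ordS j \notin A.
  apply/exists_inP; apply: contraR AT; rewrite negb_exists_in => /forall_inP AS.
  by apply/eqP/(ordS_closed iA) => j jA; have := AS j jA; rewrite negbK.
have [] := IH (A :\ j).
- by rewrite (cardsD1 j) jA in Ak.
- by apply/eqP => /setP /(_ j); rewrite !inE eqxx.
move=> u /andP[cu pu].
have mu (x : 'I_n) : (x \in u) = (x != j) && (x \in A) by rewrite (perm_mem pu) mem_enum !inE.
have cju : cyc_dec_word (j :: u).
  rewrite cdw_cons cu mu eqxx andbT /=; apply/allP => x; rewrite mu => /andP[_ xA].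
  by apply: contra SjA => /eqP<-.
exists (j :: u); rewrite cju; apply: uniq_perm.
- by move: cju; rewrite cyc_dec_wordE => /andP[].
- exact: enum_uniq.
by move=> x; rewrite inE mu mem_enum; case: eqVneq => // ->.
Qed.

End Words.

(* Meaningful for proper subsets only: [wd setT] is the junk value [[::]]. *)
Definition wd n (A : {set 'I_n}) : seq 'I_n :=
  odflt [::] (omap val [pick u : #|A|.-tuple 'I_n | cyc_dec_word u && perm_eq u (enum A)]).

Section Wd.
Variable n : nat.
Hypothesis n_gt2 : 2 < n.
Implicit Types (i j : 'I_n) (u v x y l r : seq 'I_n) (A B : {set 'I_n}).

Lemma wdP A : A != setT -> cyc_dec_word (wd A) && perm_eq (wd A) (enum A).
Proof.
move=> /(cdw_exists n_gt2)[u /andP[cu pu]]; rewrite /wd; case: pickP => [//|no].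
have su : size u == #|A| by rewrite (perm_size pu) -cardE.
by have := no (Tuple su); rewrite /= cu pu.
Qed.

Lemma wd_cdw A : A != setT -> cyc_dec_word (wd A).
Proof. by move=> /wdP /andP[]. Qed.

Lemma mem_wd A : A != setT -> wd A =i A.
Proof. by move=> /wdP /andP[_ p] i; rewrite (perm_mem p) mem_enum. Qed.

Lemma size_wd A : A != setT -> size (wd A) = #|A|.
Proof. by move=> /wdP /andP[_ p]; rewrite (perm_size p) -cardE. Qed.

Lemma weq_wd A u : A != setT -> cyc_dec_word u -> u =i A -> weq (wd A) u.
Proof.
move=> AT cu uA; apply: (cdw_weq n_gt2) => //; first exact: wd_cdw.
by move=> i; rewrite mem_wd.
Qed.
End Wd.

(** * Products of descending runs of letters *)

Local Notation succ_path := (path (fun i j => j == ordS i)).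

Section Block.
Variable n : nat.
Implicit Types (i j : 'I_n) (u v x y l r Y : seq 'I_n) (A B : {set 'I_n}).


(** Write y_1, ..., y_m for [rcons Y j] and D = y_m ... y_1. The claim is y_(m-1) ... y_1 D = D y_m
    ... y_2, the iterated form of D s_(k+1) = s_k D. The letter [i], which is y_1 - 1, is outside
    the run, so the run does not close up around the cycle. *)
Lemma weq_rev_rcons i j Y : succ_path i (rcons Y j) -> uniq (i :: rcons Y j) ->
  weq (rev Y ++ rev (rcons Y j)) (rev (rcons Y j) ++ rev (behead (rcons Y j))).
Proof.
elim: Y i => [|y1 Y IH] i; first by move=> *; exact: weq_refl.
move=> Yp Yu; move: Yp; rewrite rcons_cons /= => /andP[/eqP y1E Yp].
have y1u : uniq (y1 :: rcons Y j) by case/andP: Yu.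
have {IH} IH := IH _ Yp y1u.
have [G Ye] : exists G, rcons Y j = ordS y1 :: G.
  by case: Y Yp {IH y1u Yu} => [|y2 Y] /= /andP[/eqP -> _]; [exists [::] | exists (rcons Y j)].
move: IH; rewrite Ye /= !rev_cons -!cats1 => IH.
(* [G] is y_3, ..., y_m. None of these is y_1 - 1, because [i] is not in the run, so all commute
   with y_1. *)
have comm : weq (y1 :: rev G) (rev G ++ [:: y1]).
  rewrite cats1; apply: weq_move => g; rewrite mem_rev => gG.
  move: y1u Yu; rewrite rcons_cons Ye /= !inE !negb_or.
  case/andP=> /andP[_ y1G] /andP[S1G _] /andP[/and3P[_ _ iG] _].
  split; first by apply: contraNneq y1G => <-.
  suff: (g != ordS y1) && (y1 != ordS g) by []; apply/andP; split; first by apply: contraNneq S1G => <-.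
  by apply: contraNneq iG; rewrite y1E => /(@ordS_inj n) ->.
have braid : weq [:: y1; ordS y1; y1] [:: ordS y1; y1; ordS y1].
  exact: (weq_step [::] [::] (br_braid (erefl : nat_of_ord (ordS y1) = succ_mod y1))).
rewrite -!catA /=.
apply: (weq_trans (v := rev Y ++ rev G ++ [:: y1; ordS y1; y1])).
  by apply: weq_catl; have := weq_catr [:: ordS y1; y1] comm; rewrite -!catA.
apply: (weq_trans (v := rev Y ++ rev G ++ [:: ordS y1; y1; ordS y1])).
  by do 2 apply: weq_catl.
apply: (weq_trans (v := rev G ++ [:: ordS y1] ++ rev G ++ [:: y1; ordS y1])).
  by have := weq_catr [:: y1; ordS y1] IH; rewrite -!catA.
by do 2 apply: weq_catl; have := weq_catr [:: ordS y1] (weq_sym comm); rewrite -!catA.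
Qed.

(** D D = D (y_m ... y_2) y_1 = (y_(m-1) ... y_1) D y_1, and D ends in y_1, so two letters
    cancel. *)
Lemma weq_rev_sq i j Y : succ_path i (rcons Y j) -> uniq (i :: rcons Y j) ->
  exists2 x, weq (rev (rcons Y j) ++ rev (rcons Y j)) x & size x < (size Y).*2.+2.
Proof.
move=> Yp Yu; have W := weq_rev_rcons Yp Yu.
have [y1 [G Ye]] : exists y1 : 'I_n, exists G, rcons Y j = y1 :: G.
  by case: Y {Yp Yu W} => [|y Y]; [exists j, [::] | exists y, (rcons Y j)].
have sY : size G = size Y by have := congr1 size Ye; rewrite size_rcons => -[].
rewrite {}Ye /= in W *.
exists (rev Y ++ rev G).
  rewrite {2}rev_cons -cats1 catA; apply: weq_trans (weq_catr [:: y1] (weq_sym W)) _.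
  have := weq_step (rev Y ++ rev G) [::] (br_sq y1).
  by rewrite rev_cons -cats1 -!catA /= cats0.
by rewrite size_cat !size_rev sY addnn; lia.
Qed.
End Block.

(** * Pairs of subsets as labellings of the cycle, and the exchange of be with ea *)

Local Notation E := (false, false).
Local Notation Al := (true, false).
Local Notation Bl := (false, true).
Local Notation Cl := (true, true).

(* A pair of subsets (A, B) is encoded by recording at i whether i is in A and whether i + 1 is in B. *)
Definition setA n (t : {ffun 'I_n -> bool * bool}) : {set 'I_n} := [set i | (t i).1].
Definition setB n (t : {ffun 'I_n -> bool * bool}) : {set 'I_n} :=
  [set i | (t (ord_pred i)).2].
Definition dword n (t : {ffun 'I_n -> bool * bool}) : seq 'I_n := wd (setA t) ++ wd (setB t).

Section Toggle.
Variable n : nat.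
Hypothesis n_gt2 : 2 < n.
Implicit Types (i j : 'I_n) (Y Z : seq 'I_n) (D : {set 'I_n}).
Implicit Types t : {ffun 'I_n -> bool * bool}.

Lemma mem_setB t i : (ordS i \in setB t) = (t i).2.
Proof. by rewrite inE ordSK. Qed.

Lemma setA_proper t i : t i = E -> setA t != setT.
Proof. by move=> ti; apply/eqP => /setP /(_ i); rewrite !inE ti. Qed.

Lemma setB_proper t i : t i = E -> setB t != setT.
Proof. by move=> ti; apply/eqP => /setP /(_ (ordS i)); rewrite mem_setB inE ti. Qed.

(** A label at k governs the letter k + 1 of the second factor: the positions [i :: Y] govern the
    letters [rcons Y j]. *)
Lemma succ_path_map i Y j : succ_path i (rcons Y j) -> rcons Y j = map (@ordS n) (i :: Y).
Proof.
elim: Y i => [|k Y IH] i /= /andP[/eqP k_i Yp]; first by rewrite k_i.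
by rewrite (IH _ Yp) k_i.
Qed.

Lemma cdw_rev i Z : succ_path i Z -> uniq (i :: Z) -> cyc_dec_word (rev Z).
Proof.
elim: Z i => [|y Z IH] i //= /andP[/eqP y_i Zp] /andP[iyZ yZu].
rewrite rev_cons -cats1 cdw_cat // (IH y) //= cdw_cons //=.
case/andP: yZu => yZ _; apply/andP; split.
  by rewrite orbF (mem_rev Z y : (y \in rev Z) = _).
apply/allrelP => x z; rewrite mem_rev inE => xZ /eqP ->.
by apply: contraNneq iyZ; rewrite y_i => /(@ordS_inj n) ->; rewrite inE xZ orbT.
Qed.

(** The concatenation is itself a cyclically decreasing word with the letters of [S], and its
    letters determine such a word up to the relations. *)
Lemma weq_wd_catr D Z (S : {set 'I_n}) : D != setT -> cyc_dec_word (rev Z) ->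
  (forall x y, x \in D -> y \in Z -> y != x /\ y != ordS x) ->
  (forall x, (x \in S) = (x \in D) || (x \in Z)) ->
  weq (wd S) (wd D ++ rev Z) /\ size (wd S) = size (wd D ++ rev Z).
Proof.
move=> DT cZ DZ SE.
have cdw : cyc_dec_word (wd D ++ rev Z).
  rewrite cdw_cat // wd_cdw // cZ /=; apply/andP; split.
    apply/hasPn => y; rewrite mem_rev inE mem_wd // => yZ.
    by apply/negP => yD; have [] := DZ y y yD yZ; rewrite eqxx.
  by apply/allrelP => x y; rewrite mem_wd // mem_rev => xD yZ; have [] := DZ _ _ xD yZ.
have mem : wd D ++ rev Z =i S by move=> x; rewrite mem_cat mem_wd // mem_rev SE.
have ST : S != setT.
  by have := cdw_proper n_gt2 cdw; congr (_ != _); apply/setP => x; rewrite inE mem.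
split; first exact: weq_wd.
rewrite size_wd // -(eq_card mem); apply/card_uniqP.
by move: cdw; rewrite cyc_dec_wordE // => /andP[].
Qed.

Lemma weq_wd_catl D Z (S : {set 'I_n}) : D != setT -> cyc_dec_word (rev Z) ->
  (forall x y, x \in D -> y \in Z -> x != y /\ x != ordS y) ->
  (forall x, (x \in S) = (x \in D) || (x \in Z)) ->
  weq (wd S) (rev Z ++ wd D) /\ size (wd S) = size (rev Z ++ wd D).
Proof.
move=> DT cZ DZ SE.
have cdw : cyc_dec_word (rev Z ++ wd D).
  rewrite cdw_cat // wd_cdw // cZ /=; apply/andP; split.
    apply/hasPn => y; rewrite inE mem_rev mem_wd // => yD.
    by apply/negP => yZ; have [] := DZ y y yD yZ; rewrite eqxx.
  by apply/allrelP => x y; rewrite mem_wd // mem_rev => xZ yD; have [] := DZ _ _ yD xZ.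
have mem : rev Z ++ wd D =i S by move=> x; rewrite mem_cat mem_wd // mem_rev SE orbC.
have ST : S != setT.
  by have := cdw_proper n_gt2 cdw; congr (_ != _); apply/setP => x; rewrite inE mem.
split; first exact: weq_wd.
rewrite size_wd // -(eq_card mem); apply/card_uniqP.
by move: cdw; rewrite cyc_dec_wordE // => /andP[].
Qed.

Section Segment.
Variables (i j : 'I_n) (Y : seq 'I_n) (t : {ffun 'I_n -> bool * bool}).
Hypotheses (Yp : succ_path i (rcons Y j)) (Yu : uniq (i :: rcons Y j)).
Hypotheses (tY : forall k, k \in Y -> t k = Cl) (ti : t i = Bl).

(** Since [i] carries b and [Y] carries c, the second subset contains all of [Z] and the first
    contains [Y]. [DA] and [DB] are what the two subsets have outside [Z]. *)
Let Z := rcons Y j.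
Let DA := setA t :\: [set x in Z].
Let DB := setB t :\: [set x in Z].

Let memZ k : (k \in Z) = (k == j) || (k \in Y).
Proof. by rewrite mem_rcons inE. Qed.

Let memSZ k : (ordS k \in Z) = (k == i) || (k \in Y).
Proof. by rewrite /Z (succ_path_map Yp) mem_map ?inE //; exact: ordS_inj. Qed.

Let memDA k : (k \in DA) = (k \notin Z) && (t k).1.
Proof. by rewrite in_setD !inE. Qed.

Let memDB k : (ordS k \in DB) = (ordS k \notin Z) && (t k).2.
Proof. by rewrite in_setD mem_setB inE. Qed.

Let jZ : j \in Z. Proof. by rewrite mem_rcons mem_head. Qed.

Let cZ : cyc_dec_word (rev Z). Proof. exact: cdw_rev Yp Yu. Qed.

Let cY : cyc_dec_word (rev Y).
Proof.
by move: cZ; rewrite /Z rev_rcons cdw_cons // => /and3P[].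
Qed.

Let cbZ : cyc_dec_word (rev (behead Z)).
Proof.
apply: (cdw_subseq n_gt2) cZ; rewrite subseq_rev; case: Z => //= *; exact: subseq_cons.
Qed.

Let DAT : DA != setT.
Proof. by apply/eqP => /setP/(_ j); rewrite memDA jZ inE. Qed.

Let DBT : DB != setT.
Proof. by apply/eqP => /setP/(_ j); rewrite -[j]ord_predK memDB ord_predK jZ inE. Qed.

Let DAZ x y : x \in DA -> y \in Z -> y != x /\ y != ordS x.
Proof.
rewrite memDA => /andP[xZ tx] yZ; split; first by apply: contraNneq xZ => <-.
apply/eqP => y_x; move: yZ; rewrite y_x memSZ => /orP[/eqP xi|xY].
  by rewrite xi ti in tx.
by rewrite memZ xY orbT in xZ.
Qed.

Let DBZ x y : (t j).2 = false -> x \in DB -> y \in Z -> x != y /\ x != ordS y.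
Proof.
move=> tj xD yZ; split; first by apply: contraTneq xD => ->; rewrite in_setD inE yZ.
apply/eqP => x_y; move: xD yZ; rewrite x_y memDB memSZ memZ => /andP[].
rewrite negb_or => /andP[_ yY]; rewrite (negPf yY) orbF => ty /eqP yj.
by rewrite yj tj in ty.
Qed.

(** Now [Z] lies in both subsets, so the product is [wd DA] D D [wd DB] with D = [rev Z], and D D
    shortens. *)
Lemma weq_dword_ba : t j = Al ->
  exists2 x, weq (dword t) x & size x < size (dword t).
Proof.
move=> tj.
have [wA sA] : weq (wd (setA t)) (wd DA ++ rev Z) /\ size (wd (setA t)) = size (wd DA ++ rev Z).
  apply: weq_wd_catr => // x; rewrite memDA inE.
  case xZ: (x \in Z) => //=; last by rewrite orbF.
  by move: xZ; rewrite memZ => /orP[/eqP->|/tY->]; rewrite ?tj.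
have [wB sB] : weq (wd (setB t)) (rev Z ++ wd DB) /\ size (wd (setB t)) = size (rev Z ++ wd DB).
  apply: weq_wd_catl => // [x y|x]; first by apply: DBZ; rewrite tj.
  rewrite -[x]ord_predK mem_setB memDB.
  case xZ: (ordS _ \in Z) => //=; last by rewrite orbF.
  by move: xZ; rewrite memSZ => /orP[/eqP->|/tY->]; rewrite ?ti.
have [x wx sx] := weq_rev_sq Yp Yu.
exists (wd DA ++ x ++ wd DB).
  apply: (weq_trans (weq_cat wA wB)).
  by have := weq_catl (wd DA) (weq_catr (wd DB) wx); rewrite -!catA.
by rewrite /dword !size_cat sA sB !size_cat !size_rev /Z size_rcons; lia.
Qed.

(** Between [wd DA] and [wd DB], the word of [t] has [rev Y ++ rev Z]. In [t'] the first factor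
    gains the letter [j] and the second loses the successor of [i], which leaves
    [rev Z ++ rev (behead Z)]. The two are equal by [weq_rev_rcons]. *)
Lemma weq_dword_toggle (t' : {ffun 'I_n -> bool * bool}) : t j = E -> t' i = E -> t' j = Al ->
  (forall k, k != i -> k != j -> t' k = t k) ->
  weq (dword t) (dword t') /\ size (dword t) = size (dword t').
Proof.
move=> tj t'i t'j tt'.
have ij : i != j by move: Yu => /= /andP[/memPn /(_ _ jZ)]; rewrite eq_sym.
have iY : i \notin Y by move: Yu => /= /andP[+ _]; rewrite mem_rcons inE negb_or => /andP[].
have jY : j \notin Y by move: Yu => /= /andP[_]; rewrite rcons_uniq => /andP[].
have t'Y k : k \in Y -> t' k = Cl.
  by move=> kY; rewrite tt' ?tY //; apply: contraTneq kY => ->.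
have [wA sA] : weq (wd (setA t)) (wd DA ++ rev Y) /\ size (wd (setA t)) = size (wd DA ++ rev Y).
  apply: weq_wd_catr => // [x y xD yY|x]; first by apply: DAZ => //; rewrite memZ yY orbT.
  rewrite memDA inE memZ.
  have [->|xj] := eqVneq x j; first by rewrite tj (negPf jY).
  by case xY: (x \in Y); rewrite /= ?orbF // tY.
have [wA' sA'] : weq (wd (setA t')) (wd DA ++ rev Z) /\ size (wd (setA t')) = size (wd DA ++ rev Z).
  apply: weq_wd_catr => // x; rewrite memDA inE.
  case xZ: (x \in Z) => /=.
    by move: xZ; rewrite memZ => /orP[/eqP->|/t'Y->]; rewrite ?t'j.
  have [->|xi] := eqVneq x i; first by rewrite t'i ti.
  by rewrite orbF tt' //; apply: contraFneq xZ => ->.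
have [wB sB] : weq (wd (setB t)) (rev Z ++ wd DB) /\ size (wd (setB t)) = size (rev Z ++ wd DB).
  apply: weq_wd_catl => // [x y|x]; first by apply: DBZ; rewrite tj.
  rewrite -[x]ord_predK mem_setB memDB.
  case xZ: (ordS _ \in Z) => //=; last by rewrite orbF.
  by move: xZ; rewrite memSZ => /orP[/eqP->|/tY->]; rewrite ?ti.
have bZ : behead Z = map (@ordS n) Y by rewrite /Z (succ_path_map Yp).
have [wB' sB'] : weq (wd (setB t')) (rev (behead Z) ++ wd DB) /\
    size (wd (setB t')) = size (rev (behead Z) ++ wd DB).
  apply: weq_wd_catl => // [x y xD yZ|x].
    by apply: DBZ => //; [rewrite tj | exact: mem_behead].
  rewrite -[x]ord_predK mem_setB memDB bZ mem_map; last exact: ordS_inj.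
  move: (ord_pred x) => {x} x; rewrite memSZ.
  have [->|xi] := eqVneq x i; first by rewrite t'i (negPf iY).
  case xY: (x \in Y); first by rewrite /= t'Y.
  have [->|xj] := eqVneq x j; first by rewrite tj t'j.
  by rewrite /= orbF tt'.
split; last first.
  rewrite /dword !size_cat sA sB sA' sB' !size_cat !size_rev size_behead /Z size_rcons; lia.
apply: (weq_trans (weq_cat wA wB)).
apply: weq_sym; apply: (weq_trans (weq_cat wA' wB')).
have := weq_catl (wd DA) (weq_catr (wd DB) (weq_sym (weq_rev_rcons Yp Yu))).
by rewrite -!catA.
Qed.
End Segment.
End Toggle.


(** * Words in a, b, e as sequences of blocks *)

Section Blocks.
Implicit Types (x y X : seq (bool * bool)) (l : seq (nat * nat)).

Definition block (pq : nat * nat) : seq (bool * bool) :=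
  nseq pq.1 Bl ++ E :: nseq pq.2 Al.
Definition blocks l := flatten (map block l).

(* Reading from the right, the first component counts the letters [Al] still waiting for their [E]. *)
Definition parse_step (z : bool * bool) (st : nat * seq (nat * nat)) : nat * seq (nat * nat) :=
  if z == Al then (st.1.+1, st.2)
  else if z == Bl then (st.1, if st.2 is pq :: l then (pq.1.+1, pq.2) :: l else [::])
  else (0, (0, st.1) :: st.2).
Definition parse x := (foldr parse_step (0, [::]) x).2.

Definition not_ba (z z' : bool * bool) := ~~ ((z == Bl) && (z' == Al)).

Lemma blocksK : cancel blocks parse.
Proof.
suff fold_blocks l : foldr parse_step (0, [::]) (blocks l) = (0, l).
  by move=> l; rewrite /parse fold_blocks.
elim: l => [|[p q] l IH] //.
rewrite /blocks /= foldr_cat -/(blocks l) IH /block /= foldr_cat /=.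
have -> : foldr parse_step (0, l) (nseq q Al) = (q, l) by elim: q => //= q ->.
by elim: p => //= p ->.
Qed.

(** Without the factor ba, every label belongs to the block of a nearby e, except for labels a at
    the very beginning and labels b at the very end. *)
Lemma parseK x : Cl \notin x -> sorted not_ba x -> head E x != Al -> last E x != Bl ->
  blocks (parse x) = x.
Proof.
move=> xC xs hx lx.
(* Generalized to suffixes, which may begin with labels a whose e is still to be read. *)
suff: x = nseq (foldr parse_step (0, [::]) x).1 Al ++ blocks (parse x).
  case: (foldr parse_step (0, [::]) x).1 => [//|q] xE.
  by rewrite xE in hx.
elim: x xC xs lx {hx} => [|z x IH] //.
rewrite inE negb_or => /andP[zC xC] xs lx.
have {IH} IH : x = nseq (foldr parse_step (0, [::]) x).1 Al ++ blocks (parse x).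
  apply: IH => //; first exact: path_sorted xs.
  by case: x lx {xs xC}.
rewrite /parse /= /parse_step.
move: IH; rewrite /parse; case: (foldr _ _ x) => q l /= xE.
have [->|zA] := eqVneq z Al; first by rewrite /= {1}xE.
have [zB|zB] := eqVneq z Bl; last first.
  have -> : z = E by case: z zC zA zB {xs lx} => [] [] [].
  by rewrite /blocks /= {1}xE.
(* A label b extends the next block: waiting labels a would give the factor ba, and with no block
   left the word would end in b. *)
case: q xE => [|q] xE; last by rewrite zB xE in xs.
case: l xE => [|[p q] l] /= xE; first by rewrite xE zB in lx.
by rewrite zB {1}xE.
Qed.

Lemma count_blocks l z : count_mem z (blocks l) =
  (z == Al) * sumn (map snd l) + (z == Bl) * sumn (map fst l) + (z == E) * size l.
Proof.
elim: l => [|[p q] l IH]; first by rewrite !muln0.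
rewrite /blocks /= count_cat -/(blocks l) IH /block count_cat /= !count_nseq /=.
by case: z {IH} => [] [] [] /=; lia.
Qed.

Lemma size_blocks l : size (blocks l) = sumn (map snd l) + sumn (map fst l) + size l.
Proof.
elim: l => [|[p q] l IH] //.
rewrite /blocks /= size_cat -/(blocks l) IH /block size_cat /= !size_nseq; lia.
Qed.

Lemma C_notin_blocks l : Cl \notin blocks l.
Proof. by rewrite -has_pred1 has_count count_blocks. Qed.

Lemma head_blocks l : head E (blocks l) != Al.
Proof. by case: l => [|[[|p] q] l]. Qed.

Lemma last_blocks l : last E (blocks l) != Bl.
Proof.
elim/last_ind: l => [|l [p q] _] //.
rewrite /blocks map_rcons flatten_rcons last_cat /= last_cat /=.
suff aux z : z != Bl -> last z (nseq q Al) != Bl by exact: aux.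
by elim: q z => //= q IH z _; exact: IH.
Qed.

Definition swap (pq : nat * nat) := (pq.2, pq.1).

Lemma swapK : involutive swap. Proof. by case. Qed.

Section Toggle.
Variable R : seq (bool * bool) -> seq (bool * bool) -> Prop.
Hypotheses (Rxx : forall x, R x x) (Rsym : forall x y, R x y -> R y x).
Hypothesis Rtrans : forall x y z, R x y -> R y z -> R x z.
Hypothesis Rtoggle : forall x y, R (x ++ Bl :: E :: y) (x ++ E :: Al :: y).

(** Moving e to the left turns each b it passes into a. Thus b^p e a^q and b^q e a^p share the form
    e a^(p+q), which [toggle_blocks] uses in both directions. *)
Lemma toggle_block x y p q :
  R (x ++ block (p, q) ++ y) (x ++ block (0, p + q) ++ y).
Proof.
elim: p q => [|p IH] q; first exact: Rxx.
rewrite addSnnS; apply: Rtrans (IH q.+1).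
have := Rtoggle (x ++ nseq p Bl) (nseq q Al ++ y).
rewrite /block /= -!catA /=.
have -> : Bl :: nseq p Bl ++ E :: nseq q Al ++ y = nseq p Bl ++ Bl :: E :: nseq q Al ++ y.
  by elim: p {IH} => //= p ->.
by [].
Qed.

Lemma toggle_blocks x l : R (x ++ blocks l) (x ++ blocks (map swap l)).
Proof.
elim: l x => [|[p q] l IH] x; first exact: Rxx.
rewrite /blocks /= -!/(blocks _).
apply: (Rtrans (y := x ++ block (q, p) ++ blocks l)).
  apply: Rtrans (toggle_block _ _ _ _) _; rewrite addnC.
  exact/Rsym/toggle_block.
by rewrite !catA; exact: IH.
Qed.
End Toggle.
End Blocks.

(** * Neighbours and rotations in a filtered sequence *)

Section Filter.
Variables (T : eqType) (p : pred T).

Lemma filter_cons_inv (s r : seq T) i : filter p s = i :: r ->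
  exists s1 s2, [/\ s = s1 ++ i :: s2, all (predC p) s1 & filter p s2 = r].
Proof.
elim: s => //= x s IH; case: ifP => px.
  by case=> <- <-; exists [::], s.
by move=> /IH[s1 [s2 [-> s1p s2r]]]; exists (x :: s1), s2; rewrite /= px.
Qed.

(** In the application [p] rejects the label c, so [Y] is the run of c's between two neighbours. *)
Lemma filter_consecutive (s l r : seq T) i j : filter p s = l ++ i :: j :: r ->
  exists s1 Y s2, s = s1 ++ i :: Y ++ j :: s2 /\ all (predC p) Y.
Proof.
elim: l s => [|x l IH] s /filter_cons_inv [s1 [s2 [-> _ ]]].
  move=> /filter_cons_inv[Y [s3 [-> Yp _]]].
  by exists s1, Y, s3.
move=> /IH [s3 [Y [s4 [-> Yp]]]].
by exists (s1 ++ x :: s3), Y, s4; rewrite -catA.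
Qed.

Lemma filter_rot k (s : seq T) : filter p (rot k s) = rot (size (filter p (take k s))) (filter p s).
Proof.
by rewrite -{3}(cat_take_drop k s) filter_cat rot_size_cat /rot filter_cat.
Qed.
End Filter.


(** * Labellings read around the cycle from a chosen start; counting the starts of blocks *)

Lemma cycle_enum_ord n : cycle (fun i j : 'I_n => j == ordS i) (enum 'I_n).
Proof.
suff: cycle (fun a b => b == a.+1 %% n) (iota 0 n).
  by rewrite -val_enum_ord cycle_map.
case: n => // m; rewrite /= -addn1.
have : forall a k, a + k = m -> path (fun a b => b == a.+1 %% (m + 1)) a (rcons (iota a.+1 k) 0).
  move=> a k; elim: k a => [|k IH] a /= am; first by rewrite andbT -am addn0 addn1 modnn.
  by rewrite IH ?addSnnS // andbT modn_small //; lia.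
by apply.
Qed.

Section Diagrams.
Variable n : nat.
Implicit Types (i j k : 'I_n) (s P Y : seq 'I_n) (x y X : seq (bool * bool)).
Implicit Types t : {ffun 'I_n -> bool * bool}.

(** The cycle is cut at [k], and the positions labelled c are deleted. *)
Definition uncommon k t : seq 'I_n := [seq i <- rot k (enum 'I_n) | t i != Cl].

(** Inverse to reading labels along [P]; the default [Cl] restores the deleted positions. *)
Definition place P x : {ffun 'I_n -> bool * bool} :=
  [ffun i => if i \in P then nth Cl x (index i P) else Cl].

Lemma uncommon_uniq k t : uniq (uncommon k t).
Proof. by rewrite filter_uniq // rot_uniq enum_uniq. Qed.

Lemma mem_uncommon k t i : (i \in uncommon k t) = (t i != Cl).
Proof. by rewrite mem_filter mem_rot mem_enum andbT. Qed.

Lemma uncommon_cons k t : t k != Cl -> exists s, uncommon k t = k :: s.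
Proof.
move=> tk; have kn : k < size (enum 'I_n) by rewrite size_enum_ord.
by rewrite /uncommon /rot (drop_nth k kn) nth_ord_enum /= tk; eexists.
Qed.

Lemma map_place P x : uniq P -> size x = size P -> map (place P x) P = x.
Proof.
move=> uP sx; apply: (@eq_from_nth _ Cl); first by rewrite size_map.
move=> a; rewrite size_map => aP; case: P uP sx aP => // i0 P uP sx aP.
by rewrite (nth_map i0) // ffunE mem_nth // index_uniq.
Qed.

Lemma place_map k t : place (uncommon k t) (map t (uncommon k t)) = t.
Proof.
apply/ffunP => i; rewrite ffunE mem_uncommon.
case: ifP => [ti|/negbFE/eqP-> //].
by rewrite (nth_map i) ?nth_index ?index_mem ?mem_uncommon.
Qed.

Lemma uncommon_place k t x : size x = size (uncommon k t) -> Cl \notin x ->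
  uncommon k (place (uncommon k t) x) = uncommon k t.
Proof.
move=> sx xC; apply: eq_filter => i; rewrite ffunE mem_uncommon.
case: ifP => // ti; rewrite -has_pred1 in xC; apply/eqP => nC.
by move: xC; rewrite has_pred1 -nC mem_nth // sx index_mem mem_uncommon ti.
Qed.

Lemma uncommon_consecutive k t P1 P2 i j : uncommon k t = P1 ++ i :: j :: P2 ->
  exists Y, [/\ succ_path i (rcons Y j), uniq (i :: rcons Y j) & forall m, m \in Y -> t m = Cl].
Proof.
move=> /filter_consecutive [s1 [Y [s2 [sE Yc]]]]; exists Y.
have: cycle (fun i j => j == ordS i) (rot k (enum 'I_n)) by rewrite rot_cycle cycle_enum_ord.
have: uniq (rot k (enum 'I_n)) by rewrite rot_uniq enum_uniq.
have -> : rot k (enum 'I_n) = s1 ++ (i :: rcons Y j) ++ s2 by rewrite sE /= cat_rcons.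
rewrite cat_uniq => /and3P[_ _]; rewrite cat_uniq => /andP[-> _].
rewrite cycle_catC -catA /= rcons_cat cat_path => /andP[-> _]; split=> // m mY.
by apply/eqP; have := allP Yc _ mY; rewrite /= negbK.
Qed.

Definition mult z t := #|[set i | t i == z]|.

Lemma count_uncommon z k t : z != Cl -> count_mem z (map t (uncommon k t)) = mult z t.
Proof.
move=> zC; rewrite count_map count_filter -sum1_count (perm_big (enum 'I_n)) ?perm_rot //.
rewrite big_enum_cond /mult -sum1_card; apply: eq_bigl => i.
by rewrite inE /=; case: eqP => // ->.
Qed.

Lemma mult_place z k t x : size x = size (uncommon k t) -> Cl \notin x -> z != Cl ->
  mult z (place (uncommon k t) x) = count_mem z x.
Proof.
move=> sx xC zC; rewrite -(count_uncommon k _ zC) uncommon_place //.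
by rewrite map_place // uncommon_uniq.
Qed.

Lemma mult_total t : mult E t + mult Al t + mult Bl t + mult Cl t = n.
Proof.
have multE z : mult z t = \sum_i (t i == z).
  by rewrite /mult -sum1_card big_mkcond; apply: eq_bigr => i _; rewrite inE; case: eqP.
rewrite !multE -!big_split /= -[RHS](card_ord n) -sum1_card.
by apply: eq_bigr => i _; case: (t i) => [] [] [].
Qed.

Lemma card_setA t : #|setA t| = mult Al t + mult Cl t.
Proof.
have -> : setA t = [set i | t i == Al] :|: [set i | t i == Cl].
  by apply/setP => i; rewrite !inE; case: (t i) => [] [] [].
rewrite cardsU (_ : _ :&: _ = set0) ?cards0 ?subn0 //.
by apply/setP => i; rewrite !inE; case: (t i) => [] [] [].
Qed.

Lemma card_setB t : #|setB t| = mult Bl t + mult Cl t.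
Proof.
have -> : setB t = [set ordS i | i in [set i | t i == Bl] :|: [set i | t i == Cl]].
  apply/setP => i; rewrite -[i]ord_predK mem_setB mem_imset; last exact: ordS_inj.
  by rewrite !inE; case: (t _) => [] [] [].
rewrite card_imset; last exact: ordS_inj.
rewrite cardsU (_ : _ :&: _ = set0) ?cards0 ?subn0 //.
by apply/setP => i; rewrite !inE; case: (t i) => [] [] [].
Qed.

(** The labels read from [k] are a concatenation of whole blocks exactly when parsing loses nothing;
    the first condition makes [k] itself the first position read. *)
Definition block_start k t :=
  (t k != Cl) && (blocks (parse (map t (uncommon k t))) == map t (uncommon k t)).

Definition reflect_blocks k t :=
  place (uncommon k t) (blocks (map swap (parse (map t (uncommon k t))))).

Lemma sum_swap l : sumn (map snd (map swap l)) = sumn (map fst l) /\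
  sumn (map fst (map swap l)) = sumn (map snd l).
Proof. by rewrite -!map_comp; split; congr sumn; apply: eq_map => -[]. Qed.

(** The positions labelled c stay the same, so the reflected labelling is read along the same list
    and parses to the swapped blocks. Swapping exchanges the totals of a and b and keeps the number
    of blocks, which is the number of e's. *)
Lemma reflect_blocksP k t : block_start k t ->
  [/\ block_start k (reflect_blocks k t), reflect_blocks k (reflect_blocks k t) = t,
      mult E (reflect_blocks k t) = mult E t,
      mult Al (reflect_blocks k t) = mult Bl t & mult Bl (reflect_blocks k t) = mult Al t].
Proof.
case/andP => tk /eqP; rewrite /reflect_blocks.
set P := uncommon k t; set l := parse (map t P) => lE.
have [sl1 sl2] := sum_swap l.
have sx : size (blocks (map swap l)) = size P.
  by rewrite -(size_map t) -lE !size_blocks sl1 sl2 size_map; lia.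
have uP : uniq P by exact: uncommon_uniq.
have sP := uncommon_place sx (C_notin_blocks _).
have mP : map (place P (blocks (map swap l))) P = blocks (map swap l) by rewrite map_place.
rewrite /block_start sP mP blocksK eqxx andbT mapK; last exact: swapK.
rewrite lE place_map; split=> //.
- by rewrite -(mem_uncommon k) sP mem_uncommon.
- by rewrite mult_place ?C_notin_blocks // count_blocks -(count_uncommon k) // -lE count_blocks /= size_map.
- by rewrite mult_place ?C_notin_blocks // count_blocks -(count_uncommon k) // -lE count_blocks /= sl1; lia.
- by rewrite mult_place ?C_notin_blocks // count_blocks -(count_uncommon k) // -lE count_blocks /= sl2; lia.
Qed.

Lemma uncommon_rot k t : uncommon k t = rot (size (filter (fun i => t i != Cl) (take k (enum 'I_n))))
  (filter (fun i => t i != Cl) (enum 'I_n)).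
Proof. exact: filter_rot. Qed.

(** One fixed cut of the cycle, so that [next], [prev] and the absence of ba do not refer to a
    start. *)
Definition cyc_uncommon t := [seq i <- enum 'I_n | t i != Cl].

Definition no_cyc_ba t := cycle (relpre t not_ba) (cyc_uncommon t).

Lemma cyc_uncommon_uniq t : uniq (cyc_uncommon t).
Proof. by rewrite filter_uniq ?enum_uniq. Qed.

Lemma mem_cyc_uncommon t i : (i \in cyc_uncommon t) = (t i != Cl).
Proof. by rewrite mem_filter mem_enum andbT. Qed.

Lemma no_cyc_ba_cycle k t : no_cyc_ba t -> cycle (relpre t not_ba) (uncommon k t).
Proof. by rewrite uncommon_rot rot_cycle. Qed.

Lemma no_cyc_ba_sorted k t : no_cyc_ba t -> sorted not_ba (map t (uncommon k t)).
Proof.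
move=> /(no_cyc_ba_cycle k); rewrite sorted_map.
by case: (uncommon k t) => //= i s; rewrite rcons_path => /andP[].
Qed.

Lemma prev_cyc_uncommon k t s : uncommon k t = k :: s -> prev (cyc_uncommon t) k = last k s.
Proof.
move=> sE; have [m rE] : exists m, uncommon k t = rot m (cyc_uncommon t).
  by eexists; exact: uncommon_rot.
have := uncommon_uniq k t; rewrite sE in rE * => /= /andP[ks _].
rewrite -(prev_rot m (cyc_uncommon_uniq t)) -rE prev_nth mem_head.
by rewrite memNindex // (last_nth k).
Qed.

(** The last label read from [k] is that of its cyclic predecessor, so the end conditions of
    [parseK] become local conditions at [k]. *)
Lemma block_startE k t : no_cyc_ba t ->
  block_start k t = [&& t k != Cl, t k != Al & t (prev (cyc_uncommon t) k) != Bl].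
Proof.
move=> nba; rewrite /block_start; case tk: (t k != Cl) => //=.
have [s sE] := uncommon_cons tk.
have lE : last E (map t (uncommon k t)) = t (last k s) by rewrite sE /= last_map.
rewrite (prev_cyc_uncommon sE); apply/eqP/andP => [bE | [kA lB]].
  by rewrite -lE -bE last_blocks; split=> //;
    have := head_blocks (parse (map t (uncommon k t))); rewrite bE sE.
apply: parseK; rewrite ?lE //; last by rewrite sE.
  by apply/mapP => -[i]; rewrite mem_uncommon => /eqP ti /esym.
exact: no_cyc_ba_sorted.
Qed.

(** Each position not labelled c is exactly one of three: a block start, labelled a, or right after
    a b. The last two exclude each other since ba does not occur, and [next] counts the third kind
    by the b's; what remains is the number of e's. *)
Lemma card_block_start t : no_cyc_ba t -> #|[set k | block_start k t]| = mult E t.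
Proof.
move=> nba; have uS := cyc_uncommon_uniq t.
pose S1 := [set k | block_start k t]; pose S2 := [set k | t k == Al].
pose S3 := [set next (cyc_uncommon t) k | k in [set k | t k == Bl]].
have S3E k : k \in S3 = (t k != Cl) && (t (prev (cyc_uncommon t) k) == Bl).
  apply/imsetP/andP => [[i] | [tk tp]].
    rewrite inE => /eqP ti ->; rewrite prev_next // ti; split=> //.
    by rewrite -mem_cyc_uncommon mem_next mem_cyc_uncommon ti.
  by exists (prev (cyc_uncommon t) k); rewrite ?inE // next_prev.
have card3 : #|S3| = mult Bl t.
  by rewrite card_imset //; exact: (can_inj (prev_next uS)).
have card123 : #|S1| + (#|S2| + #|S3|) = mult E t + (mult Al t + mult Bl t).
  have S23 : [disjoint S2 & S3].
    rewrite disjoint_subset; apply/subsetP => k; rewrite [k \in S2]inE inE S3E => /eqP tk.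
    rewrite tk /=; have kS : k \in cyc_uncommon t by rewrite mem_cyc_uncommon tk.
    by have := prev_cycle nba kS; rewrite /= /not_ba tk eqxx andbT.
  have S123 : [disjoint S1 & S2 :|: S3].
    rewrite disjoint_subset; apply/subsetP => k; rewrite inE block_startE // => /and3P[tk kA pB].
    by rewrite !inE negb_or kA S3E tk.
  rewrite -[#|S2| + _]subn0 -(cards0 'I_n) -(disjoint_setI0 S23) -cardsU.
  rewrite -[LHS]subn0 -(cards0 'I_n) -(disjoint_setI0 S123) -cardsU.
  have -> : S1 :|: (S2 :|: S3) = ~: [set k | t k == Cl].
    apply/setP => k; rewrite !in_setU S3E !inE block_startE //.
    by case: (t k) (t (prev _ k)) => [] [] [] [] [] [].
  by have := cardsC [set k | t k == Cl]; have := mult_total t;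
  rewrite card_ord -/(mult Cl t); move: #|_| => c; lia.
by apply: (@addIn (mult Al t + mult Bl t)); rewrite -card123 card3.
Qed.
End Diagrams.


(** * Block reflection and the symmetry of the count of pairs *)

Section Exchange.
Variable n : nat.
Hypothesis n_gt2 : 2 < n.
Implicit Types (i j k : 'I_n) (s P Y u v : seq 'I_n) (x y X : seq (bool * bool)).
Implicit Types t : {ffun 'I_n -> bool * bool}.

Lemma weq_place_toggle k t x y :
  size (x ++ Bl :: E :: y) = size (uncommon k t) ->
  let t1 := place (uncommon k t) (x ++ Bl :: E :: y) in
  let t2 := place (uncommon k t) (x ++ E :: Al :: y) in
  weq (dword t1) (dword t2) /\ size (dword t1) = size (dword t2).
Proof.
have uP := uncommon_uniq k t; move sE: (uncommon k t) uP => P uP sxy t1 t2.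
have [P1 [i [j [P2 [PE sP1]]]]] : exists P1 i j P2, P = P1 ++ i :: j :: P2 /\ size P1 = size x.
  have := cat_take_drop (size x) P; move: sxy; rewrite size_cat /= => sxy.
  have sd : size (drop (size x) P) = (size y).+2 by rewrite size_drop -sxy; lia.
  case dE: (drop _ P) sd => [|i [|j P2]] // _ <-.
  exists (take (size x) P), i, j, P2; split=> //; rewrite size_takel // -sxy; lia.
have [Y [Yp Yu Yt]] := uncommon_consecutive (etrans sE PE).
have := uP; rewrite {1}PE cat_uniq /= inE !negb_or.
case/and3P => _ /and3P[iP1 jP1 _] /and3P[/andP[ij iP2] jP2 _].
have ii : index i P = size x.
  by rewrite PE index_cat (negPf (iP1 : i \notin P1)) /= eqxx addn0.
have ij' : index j P = (size x).+1.
  by rewrite PE index_cat (negPf (jP1 : j \notin P1)) /= (negPf ij) eqxx addn1 sP1.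
have iP : i \in P by rewrite PE mem_cat mem_head orbT.
have jP : j \in P by rewrite PE mem_cat !inE eqxx !orbT.
apply: (@weq_dword_toggle n n_gt2 i j Y) => //.
- by move=> m mY; rewrite ffunE -sE mem_uncommon Yt.
- by rewrite ffunE iP ii nth_cat ltnn subnn.
- by rewrite ffunE jP ij' nth_cat ltnNge leqnSn /= subSnn.
- by rewrite ffunE iP ii nth_cat ltnn subnn.
- by rewrite ffunE jP ij' nth_cat ltnNge leqnSn /= subSnn.
(* Every other position has index below [size x] or at least [size x + 2], where the two words
   agree. *)
move=> m mi mj; rewrite !ffunE; case: ifP => // mP; rewrite !nth_cat; case: ltnP => // le.
have m1 : index m P != size x.
  by rewrite -ii; apply: contraNneq mi => e; rewrite -(nth_index i mP) e nth_index.
have m2 : index m P != (size x).+1.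
  by rewrite -ij'; apply: contraNneq mj => e; rewrite -(nth_index i mP) e nth_index.
have /subnKC <- : (size x).+2 <= index m P by rewrite 2!ltn_neqAle eq_sym m2 eq_sym m1.
by rewrite -addn2 -addnA addKn.
Qed.

Lemma weq_reflect_blocks k t : block_start k t ->
  weq (dword t) (dword (reflect_blocks k t)) /\
  size (dword t) = size (dword (reflect_blocks k t)).
Proof.
case/andP => tk /eqP; rewrite /reflect_blocks.
set P := uncommon k t; set l := parse (map t P) => lE.
(* Only words of the length of [P] can be placed; equality of lengths belongs to [R] so that this
   condition passes along a chain of exchanges. *)
pose R x y := size x = size y /\ (size x = size P ->
  weq (dword (place P x)) (dword (place P y)) /\ size (dword (place P x)) = size (dword (place P y))).
have [||||_] := @toggle_blocks R _ _ _ _ [::] l.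
- by move=> x; split=> // _; split=> //; exact: weq_refl.
- move=> x y [sxy xy]; split=> // sy; rewrite -sxy in sy.
  by have [w e] := xy sy; split=> //; exact: weq_sym.
- move=> x y z [sxy xy] [syz yz]; split=> [|sx]; first by rewrite sxy.
  have [w e] := xy sx; have [w' e'] := yz (etrans (esym sxy) sx).
  by split; [exact: weq_trans w w' | rewrite e].
- move=> x y; split; first by rewrite !size_cat.
  exact: weq_place_toggle.
by rewrite /= lE place_map; apply; rewrite size_map.
Qed.

(** Cutting the cycle at the b of an occurrence of ba puts that pair at the front of the word
    read. *)
Lemma cyc_ba_not_reduced t : ~~ no_cyc_ba t ->
  exists2 x, weq (dword t) x & size x < size (dword t).
Proof.
move=> nba; have uS := cyc_uncommon_uniq t.
have [i iS] : exists2 i, i \in cyc_uncommon t & ~~ relpre t not_ba i (next (cyc_uncommon t) i).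
  apply/hasP; apply: contraNT nba; rewrite -all_predC => /allP bad.
  apply: cycle_from_next => // i iS; have := bad i iS; by rewrite /= negbK.
rewrite /= negbK => /andP[/eqP ti /eqP tj].
have [s sE] : exists s, uncommon i t = i :: s by apply: uncommon_cons; rewrite ti.
have [m rE] : exists m, uncommon i t = rot m (cyc_uncommon t) by eexists; exact: uncommon_rot.
have nE : next (cyc_uncommon t) i = next (i :: s) i by rewrite -sE rE next_rot.
case: s sE nE => [|j s] sE nE; first by move: tj; rewrite nE /= eqxx ti.
move: nE tj; rewrite /= eqxx => -> tj.
have [Y [Yp Yu Yt]] := @uncommon_consecutive n i t [::] s i j sE.
exact: weq_dword_ba Yp Yu Yt ti tj.
Qed.

(** A weight on words that depends only on product and size and vanishes on non-reduced words. It
    will count the ways to complete a word by further factors. *)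
Variable H : seq 'I_n -> nat.
Hypothesis H_weq : forall u v, weq u v -> size u = size v -> H u = H v.
Hypothesis H_short : forall u v, weq u v -> size v < size u -> H u = 0.

Lemma H_cyc_ba t : ~~ no_cyc_ba t -> H (dword t) = 0.
Proof. by case/cyc_ba_not_reduced => x; exact: H_short. Qed.

Definition has_sizes a b m t := [&& #|setA t| == a, #|setB t| == b & mult E t == m].

Lemma reflect_has_sizes k t a b m : block_start k t -> has_sizes a b m t ->
  has_sizes b a m (reflect_blocks k t).
Proof.
move=> /reflect_blocksP[_ _ eE eA eB] /and3P[/eqP <- /eqP <- /eqP <-].
have := mult_total t; have := mult_total (reflect_blocks k t).
rewrite eE eA eB /has_sizes !card_setA !card_setB eE eA eB eqxx andbT => e1 e2.
by apply/andP; split; apply/eqP; lia.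
Qed.

(** Double counting of labellings with a marked block start; those with a cyclic ba have weight
    0. *)
Lemma sum_block_start a b m :
  m * \sum_(t | has_sizes a b m t) H (dword t) =
  \sum_k \sum_(t | has_sizes a b m t && block_start k t) H (dword t).
Proof.
under [RHS]eq_bigr do rewrite big_mkcondr.
rewrite exchange_big big_distrr /=; apply: eq_bigr => t /and3P[_ _ /eqP <-].
have [nba|/H_cyc_ba h0] := boolP (no_cyc_ba t); last first.
  by rewrite h0 muln0 big1 // => k _; case: ifP.
rewrite -big_mkcond /= sum_nat_const -card_block_start // cardsE; by [].
Qed.

(** For each fixed start, reflecting the blocks is a weight-preserving involution that exchanges the
    two sizes; the factor [m] is then cancelled. *)
Lemma sum_has_sizes_sym a b m : 0 < m ->
  \sum_(t | has_sizes a b m t) H (dword t) = \sum_(t | has_sizes b a m t) H (dword t).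
Proof.
move=> m_gt0; apply/eqP; rewrite -(eqn_pmul2l m_gt0); apply/eqP.
rewrite !sum_block_start; apply: eq_bigr => k _.
rewrite (reindex_onto (reflect_blocks k) (reflect_blocks k)) /=; last first.
  by move=> t /andP[_ /reflect_blocksP[]].
apply: eq_big => [t|t].
  apply/andP/andP => [[/andP[sh st] /eqP tt]|[sh st]].
    have [st' _ _ _ _] := reflect_blocksP st.
    by rewrite -tt; split=> //; exact: reflect_has_sizes.
  by have [-> -> _ _ _] := reflect_blocksP st; rewrite eqxx reflect_has_sizes.
move=> /andP[/andP[_ st] /eqP tt].
have [st' _ _ _ _] := reflect_blocksP st; rewrite tt in st'.
by have [w e] := weq_reflect_blocks st'; symmetry; exact: H_weq.
Qed.

Lemma path_no_a s t i : t i = Bl -> path (relpre t not_ba) i s ->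
  (forall j, j \in s -> t j != E /\ t j != Cl) -> forall j, j \in s -> t j != Al.
Proof.
elim: s i => //= k s IH i ti /andP[ik ps] nEC j.
have tk : t k = Bl.
  have := nEC k (mem_head _ _); move: ik; rewrite /= /not_ba ti eqxx.
  by case: (t k) => [] [] [] // _ [].
rewrite inE => /orP[/eqP->|js]; first by rewrite tk.
by apply: IH tk ps _ j js => j' j's; apply: nEC; rewrite inE j's orbT.
Qed.

(** Without e, a position outside the first subset carries b, and one whose successor is outside the
    second carries a. On the way around the cycle from that b to that a, a factor ba must occur. *)
Lemma H_no_E t : setA t != setT -> setB t != setT -> mult E t = 0 -> H (dword t) = 0.
Proof.
move=> AT BT /eqP; rewrite cards_eq0 => /eqP nE.
have [nba|/H_cyc_ba //] := boolP (no_cyc_ba t).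
have tE i : t i != E by have := in_set0 i; rewrite -nE inE => ->.
have notin (S : {set 'I_n}) : S != setT -> exists i, i \notin S.
  by rewrite -subTset => /subsetPn[i _ iS]; exists i.
have [i iA] := notin _ AT; have [j jB] := notin _ BT.
rewrite -[j]ord_predK mem_setB in jB; move: (ord_pred j) jB => {}j tj.
rewrite inE in iA.
have {iA} ti : t i = Bl by have := tE i; case: (t i) iA => [] [] [].
have {tj} tj : t j = Al by have := tE j; case: (t j) tj => [] [] [].
have [s sE] : exists s, uncommon i t = i :: s by apply: uncommon_cons; rewrite ti.
have := no_cyc_ba_cycle i nba; rewrite sE /= rcons_path => /andP[ps _].
have : j \in uncommon i t by rewrite mem_uncommon tj.
rewrite sE inE => /orP[/eqP ji|js]; first by rewrite ji ti in tj.
have := path_no_a ti ps _ js; rewrite tj eqxx => /(_ _)/negP; case=> //.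
move=> m ms; split=> //; have : m \in uncommon i t by rewrite sE inE ms orbT.
by rewrite mem_uncommon.
Qed.

Lemma sum_wd_sym a b :
  \sum_(A | (A != setT) && (#|A| == a)) \sum_(B | (B != setT) && (#|B| == b)) H (wd A ++ wd B) =
  \sum_(A | (A != setT) && (#|A| == b)) \sum_(B | (B != setT) && (#|B| == a)) H (wd A ++ wd B).
Proof.
(* The pairs are sorted by the number of e's. It is written [m.+1], since pairs without e contribute
   0 by [H_no_E]. *)
suff diag a' b' : \sum_(A | (A != setT) && (#|A| == a'))
    \sum_(B | (B != setT) && (#|B| == b')) H (wd A ++ wd B) =
    \sum_(m < n) \sum_(t | has_sizes a' b' m.+1 t) H (dword t).
  by rewrite !diag; apply: eq_bigr => m _; exact: sum_has_sizes_sym.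
rewrite pair_big /=.
pose dec (p : {set 'I_n} * {set 'I_n}) : {ffun 'I_n -> bool * bool} :=
  [ffun i => (i \in p.1, ordS i \in p.2)].
rewrite (reindex (fun t => (setA t, setB t))) /=; last first.
  exists dec => [t|[A B]] _; first by apply/ffunP => i; rewrite ffunE inE mem_setB; case: (t i).
  congr (_, _); apply/setP => i; first by rewrite inE ffunE.
  by rewrite -[i]ord_predK mem_setB ffunE.
rewrite (bigID (fun t => mult E t == 0)) /= big1 ?add0n; last first.
  by move=> t /andP[/andP[/andP[AT _] /andP[BT _]] /eqP e]; exact: H_no_E.
have mlt t : mult E t != 0 -> (mult E t).-1 < n.
  have := mult_total t; lia.
pose f t : 'I_n := insubd (Ordinal (ltnW (ltnW n_gt2))) (mult E t).-1.
rewrite (partition_big f predT) //=; apply: eq_bigr => m _; apply: eq_bigl => t.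
rewrite /has_sizes; apply/andP/and3P => [[/andP[/andP[/andP[_ ->] /andP[_ ->]] e] /eqP fm]|[-> -> /eqP e]].
  split=> //; rewrite -fm /f val_insubd mlt //; move: e; lia.
have ne : mult E t != 0 by rewrite e.
(* A position i labelled e shows both subsets to be proper: the first misses i, the second i + 1. *)
have [i] : exists i, i \in [set i | t i == E] by apply/set0Pn; rewrite -cards_eq0.
rewrite inE => /eqP ti.
rewrite !andbT (setA_proper ti) (setB_proper ti) ne; split=> //.
by apply/eqP/val_inj; rewrite /f val_insubd mlt // e.
Qed.
End Exchange.

(** * An action on the integers, by which d_A determines A *)

Section Action.
Variable n : nat.
Hypothesis n_gt2 : 2 < n.
Implicit Types (i j k : 'I_n) (u v : seq 'I_n) (x : int) (A B : {set 'I_n}).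

(* In the action on the integers where s_i exchanges x and x + 1 for x = i mod n, a word
   that uses the letter k at most once preserves the half-line x <= k iff it avoids k: this
   recovers A from d_A. *)
Definition residue x : 'I_n := insubd (Ordinal (ltnW (ltnW n_gt2))) `|(x %% n)%Z|%N.

Lemma modz_residue x : (x %% n)%Z = residue x.
Proof.
have n0 : (0 < n%:Z)%R by lia.
have nn : (n%:Z != 0)%R by lia.
have := modz_ge0 x nn; have := ltz_pmod x n0 => lt ge.
rewrite /residue val_insubd; case: ifP; lia.
Qed.

Lemma residueS x : residue (x + 1) = ordS (residue x).
Proof.
have : ((x + 1)%R %% n)%Z = ((residue x).+1 %% n)%N.
  by rewrite -modzDml (modz_residue x) -modz_nat -[in RHS]addn1 PoszD.
by rewrite modz_residue => -[e]; apply: val_inj.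
Qed.

Lemma residue_nat k : residue (k : nat) = k.
Proof. by apply: val_inj; have := modz_residue (k : nat); rewrite modz_nat modn_small // => -[]. Qed.

Lemma residueB x k : (residue (x - 1) == k) = (residue x == ordS k).
Proof. by rewrite -{2}[x](GRing.subrK 1%R) residueS (inj_eq (@ordS_inj n)). Qed.

Definition act i x : int :=
  if residue x == i then (x + 1)%R else if residue x == ordS i then (x - 1)%R else x.

Lemma actK i : involutive (act i).
Proof.
move=> x; rewrite /act; have [xi|xi] := eqVneq (residue x) i.
  rewrite residueS xi eqxx (negPf (ordS_neq n_gt2 i)); lia.
have [xSi|xSi] := eqVneq (residue x) (ordS i); last by rewrite (negPf xi) (negPf xSi).
by rewrite residueB xSi eqxx; lia.
Qed.

Lemma act_up i x : residue x = i -> act i x = (x + 1)%R.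
Proof. by rewrite /act => ->; rewrite eqxx. Qed.

Lemma act_down i x : residue x = ordS i -> act i x = (x - 1)%R.
Proof. by rewrite /act => ->; rewrite (negPf (ordS_neq n_gt2 i)) eqxx. Qed.

Lemma act_id i x : residue x != i -> residue x != ordS i -> act i x = x.
Proof. by rewrite /act => /negPf -> /negPf ->. Qed.

(** Both sides exchange x and x + 2 for x = i mod n and fix all other integers. *)
Lemma act_braid i x : act i (act (ordS i) (act i x)) = act (ordS i) (act i (act (ordS i) x)).
Proof.
have S1 j : ordS j != j := ordS_neq n_gt2 j.
have S2 j : ordS (ordS j) != j := ordSS_neq n_gt2 j.
have pred y k : residue y = ordS k -> residue (y - 1) = k.
  by move=> yk; apply/eqP; rewrite residueB yk.
have [xi|xi] := eqVneq (residue x) i.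
  have x1 : residue (x + 1) = ordS i by rewrite residueS xi.
  have x2 : residue (x + 1 + 1) = ordS (ordS i) by rewrite residueS x1.
  rewrite (act_up xi) (act_up x1) [act (ordS i) x]act_id ?xi 1?eq_sym // (act_up xi) (act_up x1).
  by rewrite act_id ?x2.
have [xj|xj] := eqVneq (residue x) (ordS i).
  have x1 : residue (x + 1) = ordS (ordS i) by rewrite residueS xj.
  have x2 : residue (x - 1) = i by exact: pred.
  rewrite (act_down xj) (act_up xj) [act (ordS i) (x - 1)]act_id ?x2 1?eq_sym //.
  by rewrite [act i (x + 1)]act_id ?x1 // (act_up x2) (act_down x1); lia.
have [xk|xk] := eqVneq (residue x) (ordS (ordS i)).
  have x1 : residue (x - 1) = ordS i by exact: pred.
  have x2 : residue (x - 1 - 1) = i by exact: pred.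
  rewrite [act i x]act_id // (act_down xk) (act_down x1).
  by rewrite act_id ?x2 1?eq_sym.
by do 2! rewrite !(act_id xj xk) !(act_id xi xj).
Qed.

Lemma act_comm i j x : i != j -> ~~ adjacent i j -> act i (act j x) = act j (act i x).
Proof.
move=> ij; rewrite adjacentE negb_or => /andP[jSi iSj].
have Sij : ordS i != ordS j by rewrite inj_eq //; exact: ordS_inj.
have pred y k : residue y = ordS k -> residue (y - 1) = k.
  by move=> yk; apply/eqP; rewrite residueB yk.
have half a b : a != b -> b != ordS a -> a != ordS b -> ordS a != ordS b -> 
    residue x = a \/ residue x = ordS a -> act a (act b x) = act b (act a x).
  move=> ab bSa aSb Sab [xa|xa].
    by rewrite [act b x]act_id ?xa // (act_up xa) act_id // residueS xa // eq_sym.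
  rewrite [act b x]act_id ?xa 1?eq_sym // 1?eq_sym // (act_down xa).
  by rewrite act_id ?(pred _ _ xa).
have [xi|xi] := eqVneq (residue x) i; first by apply: half => //; left.
have [xi'|xi'] := eqVneq (residue x) (ordS i); first by apply: half => //; right.
rewrite [act i x]act_id //.
have [xj|xj] := eqVneq (residue x) j.
  by rewrite (act_up xj) act_id // residueS xj // eq_sym.
have [xj'|xj'] := eqVneq (residue x) (ordS j).
  by rewrite (act_down xj') act_id ?(pred _ _ xj') // eq_sym.
by rewrite [act j x]act_id // act_id.
Qed.

Definition wact u x := foldr act x u.

Lemma wact_weq u v : weq u v -> wact u =1 wact v.
Proof.
elim=> {u v} [u|u v _ IH|u v w _ IH1 _ IH2|u v l r uv] x //; first by rewrite IH1.
rewrite /wact !foldr_cat; congr (foldr _ _ l); move: (foldr act x r) => {l r} y.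
case: uv => [i|i j jSi|i j ij adj] /=; first exact: actK.
  have -> : j = ordS i by exact: val_inj.
  exact: act_braid.
exact: act_comm.
Qed.

(** Only the exchange of the integers k and k + 1 crosses the boundary of the half-line, and it
    belongs to the letter of residue k. *)
Lemma act_half k i x : i != k -> (act i x <= (k : nat))%R = (x <= (k : nat))%R.
Proof.
move=> ik; rewrite /act; case: eqP => [xi|_].
  have : x != (k : nat) by apply: contraNneq ik => xk; rewrite -xi xk residue_nat.
  lia.
case: eqP => // xi.
have : (x - 1)%R != (k : nat).
  apply: contraNneq ik => xk; rewrite -[k]residue_nat -xk; apply/eqP/esym/eqP.
  by rewrite residueB xi.
lia.
Qed.

Lemma wact_half k u x : k \notin u -> (wact u x <= (k : nat))%R = (x <= (k : nat))%R.
Proof.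
elim: u => //= i u IH; rewrite inE negb_or => /andP[ki ku].
by rewrite act_half ?IH // eq_sym.
Qed.

Lemma wact_rev u : cancel (wact (rev u)) (wact u).
Proof.
elim: u => //= i u IH x; rewrite /wact rev_cons -cats1 foldr_cat /=.
by rewrite -/(wact _ _) IH actK.
Qed.

Lemma weq_wd_subset A B : A != setT -> B != setT -> weq (wd A) (wd B) -> A \subset B.
Proof.
move=> AT BT AB; apply/subsetP => k kA; apply: contraT => kB.
have kB' : k \notin wd B by rewrite mem_wd.
have : k \in wd A by rewrite mem_wd.
case/splitPr E : (wd A) / => [u1 u2].
have : uniq (wd A) by have := wd_cdw n_gt2 AT; rewrite cyc_dec_wordE // => /andP[].
rewrite E cat_uniq /= negb_or => /and3P[_ /andP[k1 _] /andP[k2 _]].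
(* The letters in [u2] carry this [x] to k, the letter k lifts it to k + 1, and [u1] keeps it above
   k. But [x] itself is at most k, and [wd B] avoids k. *)
pose x := wact (rev u2) (k : nat).
have := wact_half x kB'; rewrite -(wact_weq AB) E /wact foldr_cat /= -/(wact u2 x) -/(wact u1 _).
rewrite /x wact_rev wact_half // act_up ?residue_nat // wact_half ?mem_rev //.
lia.
Qed.

Lemma wd_inj A B : A != setT -> B != setT -> weq (wd A) (wd B) -> A = B.
Proof.
move=> AT BT AB; apply/eqP; rewrite eqEsubset !weq_wd_subset //; exact: weq_sym.
Qed.
End Action.

(** * Counting sequences of subsets with prescribed sizes *)

Section Count.
Variable n : nat.
Hypothesis n_gt2 : 2 < n.
Implicit Types (A B : {set 'I_n}) (F : seq 'I_n -> bool) (s : seq nat) (l : seq {set 'I_n}).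

Definition proper_of_size a A := (A != setT) && (#|A| == a).

(** The word of the factors already chosen is absorbed into the predicate [F], so that inductions
    can vary [F]. *)
Fixpoint fact_list F s : seq (seq {set 'I_n}) :=
  if s is a :: s' then
    [seq A :: l | A <- enum (proper_of_size a), l <- fact_list (fun x => F (wd A ++ x)) s']
  else if F [::] then [:: [::]] else [::].

Lemma mem_fact_list F s l : (l \in fact_list F s) =
  all2 proper_of_size s l && F (flatten (map (@wd n) l)).
Proof.
elim: s F l => [|a s IH] F [|A l] /=.
- by case: (F [::]).
- by case: (F [::]); rewrite ?inE.
- by apply/allpairsPdep => -[? [? [_ _]]].
apply/allpairsPdep/idP => [[B [l' [Ba l'F [-> ->]]]]|/andP[/andP[Aa sl] Fl]].
  rewrite mem_enum in Ba; move: l'F; rewrite IH => /andP[-> ->].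
  by rewrite (Ba : proper_of_size a B).
by exists A, l; rewrite mem_enum IH sl.
Qed.

Lemma fact_list_uniq F s : uniq (fact_list F s).
Proof.
elim: s F => [|a s IH] F /=; first by case: (F _).
apply: allpairs_uniq_dep => [|A _|]; [exact: enum_uniq | exact: IH |].
by move=> [A l] [B l'] _ _ /= [-> ->].
Qed.

Definition cnt F s := size (fact_list F s).

Lemma cnt_cons F a s :
  cnt F (a :: s) = \sum_(A | proper_of_size a A) cnt (fun x => F (wd A ++ x)) s.
Proof.
by rewrite /cnt /= size_allpairs_dep sumnE big_map big_enum.
Qed.

Lemma eq_cnt F F' s : F =1 F' -> cnt F s = cnt F' s.
Proof. by move=> FF'; rewrite (_ : F = F') //; apply: funext. Qed.

Lemma cnt_pred0 F s : F =1 xpred0 -> cnt F s = 0.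
Proof.
elim: s F => [|a s IH] F F0; first by rewrite /cnt /= F0.
by rewrite cnt_cons big1 // => A _; apply: IH => x; exact: F0.
Qed.

(** What is needed of being a reduced word of a given element; unlike that property, it survives
    fixing a prefix. *)
Definition reduced_pred F :=
  (forall u v, weq u v -> size u = size v -> F u = F v) /\
  (forall u v, weq u v -> size v < size u -> F u = false).

Lemma reduced_pred_catl F u : reduced_pred F -> reduced_pred (fun x => F (u ++ x)).
Proof.
move=> [F1 F2]; split=> x y xy sxy; first by apply: F1; [exact: weq_catl | rewrite !size_cat sxy].
by apply: F2 (weq_catl u xy) _; rewrite !size_cat ltn_add2l.
Qed.

(** [H u] counts the completions of [u] by factors of sizes [s]; it inherits from [F] the two
    properties that [sum_wd_sym] requires. *)
Lemma cnt_swap F a b s : reduced_pred F -> cnt F (a :: b :: s) = cnt F (b :: a :: s).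
Proof.
move=> [F1 F2]; pose H u := cnt (fun x => F (u ++ x)) s.
have H1 u v : weq u v -> size u = size v -> H u = H v.
  move=> uv suv; apply: eq_cnt => x; apply: F1; [exact: weq_catr | by rewrite !size_cat suv].
have H2 u v : weq u v -> size v < size u -> H u = 0.
  move=> uv suv; apply: cnt_pred0 => x; apply: F2 (weq_catr x uv) _.
  by rewrite !size_cat ltn_add2r.
have cntE c d : cnt F (c :: d :: s) = \sum_(A | proper_of_size c A)
    \sum_(B | proper_of_size d B) H (wd A ++ wd B).
  rewrite cnt_cons; apply: eq_bigr => A _; rewrite cnt_cons; apply: eq_bigr => B _.
  by apply: eq_cnt => x; rewrite catA.
rewrite !cntE; exact: (sum_wd_sym n_gt2 H1 H2 a b).
Qed.

Lemma cnt_move F a s r : reduced_pred F -> cnt F (s ++ a :: r) = cnt F (a :: s ++ r).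
Proof.
elim: s F => // b s IH F redF; rewrite cat_cons cnt_swap // !cnt_cons.
by apply: eq_bigr => A _; apply: IH; exact: reduced_pred_catl.
Qed.

Lemma cnt_perm F s r : reduced_pred F -> perm_eq s r -> cnt F s = cnt F r.
Proof.
elim: s F r => [|a s IH] F r redF; first by rewrite perm_sym => /perm_nilP ->.
move=> sr; have ar : a \in r by rewrite -(perm_mem sr) mem_head.
case/splitPr: ar sr => r1 r2; rewrite perm_sym -[a :: r2]cat1s perm_catCA perm_cons perm_sym => sr.
rewrite cnt_move // !cnt_cons; apply: eq_bigr => A _.
by apply: IH sr; exact: reduced_pred_catl.
Qed.

Lemma set0_proper : (set0 : {set 'I_n}) != setT.
Proof. by apply/eqP => /setP /(_ (Ordinal (ltnW (ltnW n_gt2)))); rewrite !inE. Qed.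

Lemma wd_set0 : wd (set0 : {set 'I_n}) = [::].
Proof. by apply: size0nil; rewrite size_wd ?set0_proper // cards0. Qed.

(** A factor of size 0 is the empty set, with empty word. This makes exponent lists with different
    bounds comparable. *)
Lemma cnt_nonzero F s : cnt F s = cnt F [seq a <- s | a != 0].
Proof.
elim: s F => [|a s IH] F //=; case: eqVneq => [->|_] /=; last first.
  by rewrite !cnt_cons; apply: eq_bigr => A _; exact: IH.
rewrite cnt_cons (big_pred1 set0) ?wd_set0; first exact: IH.
move=> A; rewrite /proper_of_size cards_eq0 /=.
by case: (eqVneq A set0) => [->|]; rewrite ?set0_proper ?andbF.
Qed.
End Count.

(** * Factorizations in the group and the coefficients of the series *)

Section Factorizations.
Variable n : nat.
Hypothesis n_gt2 : 2 < n.
Variable w : affS n.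
Implicit Types (A B : {set 'I_n}) (u v : seq 'I_n) (l : seq {set 'I_n}) (alpha : nat -> nat).

Lemma inw_weq (x : affS n) u v : inw x u -> weq u v -> inw x v.
Proof.
case: x => P [u0 Pu]; rewrite /inw /= => /Pu u0u uv.
by apply/Pu; exact: weq_trans u0u uv.
Qed.

Lemma inw_inw (x : affS n) u v : inw x u -> inw x v -> weq u v.
Proof.
case: x => P [u0 Pu]; rewrite /inw /= => /Pu u0u /Pu u0v.
exact: weq_trans (weq_sym u0u) u0v.
Qed.

(** Elements are predicates paired with proofs, so equality takes extensionality and proof
    irrelevance. *)
Lemma cls_eq (x : affS n) u : inw x u -> x = cls u.
Proof.
move=> xu; have e : proj1_sig x = proj1_sig (cls u).
  by apply: funext => v; apply: propext; split=> [|uv]; [exact: inw_inw xu | exact: inw_weq xu uv].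
case: x e {xu} => P HP /= e; move: HP; rewrite e => HP.
by congr (exist _ _ _); exact: Prop_irrelevance.
Qed.

Lemma cls_weq u v : cls u = cls v -> weq u v.
Proof.
move=> e; have : inw (cls v) v by exact: weq_refl.
by rewrite -e.
Qed.

Lemma length_is_size (x : affS n) k u : length_is x k -> inw x u -> reduced u -> size u = k.
Proof.
move=> [v [xv [rv <-]]] xu ru; apply: reduced_weq => //; exact: inw_inw xu xv.
Qed.

Lemma length_is_fun (x : affS n) k k' : length_is x k -> length_is x k' -> k = k'.
Proof. by move=> [u [xu [ru <-]]] /length_is_size; exact. Qed.

Lemma length_isE (x : affS n) : exists k, length_is x k.
Proof.
have ex : exists k, `[< exists u, inw x u /\ size u = k >].
  case: x => P [u0 Pu]; exists (size u0); apply/asboolP; exists u0; split=> //.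
  by apply/Pu; exact: weq_refl.
have [k /asboolP[u [xu su]] kmin] := ex_minnP ex; exists k, u; split=> //; split=> // v uv.
rewrite su; apply: kmin; apply/asboolP; exists v; split=> //; exact: inw_weq xu uv.
Qed.

Lemma length_is_one k : length_is (Defs.one n) k -> k = 0.
Proof.
move=> [u [xu [ru <-]]]; apply/eqP; rewrite -leqn0.
by apply: (ru [::]); exact: weq_sym.
Qed.

Definition reduced_word_of : seq 'I_n -> bool := fun u => `[< inw w u /\ reduced u >].

Lemma reduced_word_of_pred : reduced_pred reduced_word_of.
Proof.
split=> u v uv suv; last first.
  by apply/asboolP => -[_ ru]; have := ru _ uv; rewrite leqNgt suv.
have half x y : weq x y -> size x = size y -> inw w x /\ reduced x -> inw w y /\ reduced y.
  move=> xy sxy [wx rx]; split; first exact: inw_weq wx xy.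
  by move=> z yz; rewrite -sxy; apply: rx; exact: weq_trans xy yz.
by apply/asboolP/asboolP; apply: half => //; exact: weq_sym.
Qed.

(* Past the end of [l] the default [set0] yields the identity, as [wd set0 = [::]]. *)
Definition seq_fact l : nat -> affS n := fun i => cls (wd (nth set0 l i)).

(** The bound in a factorization and the bound on the support of [alpha] need not agree. *)
Lemma flatten_iota_nil (T : Type) (g : nat -> seq T) M N :
  (forall i, M <= i -> g i = [::]) -> (forall i, N <= i -> g i = [::]) ->
  flatten [seq g i | i <- iota 0 M] = flatten [seq g i | i <- iota 0 N].
Proof.
have half a b : a <= b -> (forall i, a <= i -> g i = [::]) ->
    flatten [seq g i | i <- iota 0 a] = flatten [seq g i | i <- iota 0 b].
  move=> ab ga; rewrite -(subnKC ab) iotaD map_cat flatten_cat add0n.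
  have tail d c : a <= c -> flatten [seq g i | i <- iota c d] = [::].
    by elim: d c => //= d IH c ac; rewrite ga // IH // leqW.
  by rewrite (tail (b - a) a) ?cats0.
by case/orP: (leq_total M N) => le gM gN; [exact: half | symmetry; exact: half].
Qed.

Lemma size_flatten_iota (T : Type) (g : nat -> seq T) N :
  size (flatten [seq g i | i <- iota 0 N]) = \sum_(i < N) size (g i).
Proof.
by rewrite size_flatten sumnE /shape -map_comp big_map -{1}[N]subn0 -/(index_iota 0 N) big_mkord.
Qed.

Lemma all2_map_iota alpha N l : all2 (@proper_of_size n) (map alpha (iota 0 N)) l <->
  size l = N /\ forall i, i < N -> proper_of_size (alpha i) (nth set0 l i).
Proof.
rewrite -[map _ _]/(mkseq alpha N) all2E size_mkseq; split=> [/andP[/eqP sl /all_nthP h]|[sl h]].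
  split=> // i iN; have := h (0, set0) i; rewrite size_zip size_mkseq -sl minnn => /(_ iN).
  by rewrite nth_zip ?size_mkseq // nth_mkseq.
rewrite sl eqxx; apply/(all_nthP (0, set0)) => i; rewrite size_zip size_mkseq sl minnn => iN.
by rewrite nth_zip ?size_mkseq // nth_mkseq //; exact: h.
Qed.

Lemma seq_fact_factorization alpha N l : (forall i, N <= i -> alpha i = 0) ->
  l \in fact_list reduced_word_of (map alpha (iota 0 N)) ->
  factorization w alpha (seq_fact l).
Proof.
move=> a0; rewrite mem_fact_list => /andP[/all2_map_iota[sl lP] /asboolP[wl rl]].
have lE : l = [seq nth set0 l i | i <- iota 0 N] by rewrite -sl -/(mkseq _ _) mkseq_nth.
have lp i : proper_of_size (alpha i) (nth set0 l i).
  case: (ltnP i N) => [/lP //|Ni]; rewrite nth_default ?sl //.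
  by rewrite /proper_of_size a0 // cards0 set0_proper.
have rd i : reduced (wd (nth set0 l i)).
  case: (ltnP i N) => Ni; last by rewrite nth_default ?sl // wd_set0.
  move: rl; rewrite -{1}(cat_take_drop i l) (drop_nth set0) ?sl //.
  by rewrite map_cat flatten_cat /=; exact: reduced_factor.
have iw i : inw (seq_fact l i) (wd (nth set0 l i)) by exact: weq_refl.
split; [|split].
- move=> i; have /andP[pi _] := lp i.
  by exists (wd (nth set0 l i)); split=> //; split=> //; exact: wd_cdw.
- move=> i; have /andP[pi /eqP si] := lp i.
  by exists (wd (nth set0 l i)); split=> //; split=> //; rewrite size_wd.
exists N; split; [|split].
- by move=> i Ni; rewrite /seq_fact nth_default ?sl // wd_set0.
- exists (fun i => wd (nth set0 l i)); split=> //.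
  by move: wl; rewrite {1}lE -map_comp.
exists (size (flatten (map (@wd n) l))); split; first by exists (flatten (map (@wd n) l)).
rewrite {1}lE -map_comp size_flatten_iota; apply: eq_bigr => i _ /=.
by have /andP[pi /eqP si] := lp i; rewrite size_wd.
Qed.

Lemma factorization_seq_fact alpha N (v : nat -> affS n) : (forall i, N <= i -> alpha i = 0) ->
  factorization w alpha v ->
  exists2 l, l \in fact_list reduced_word_of (map alpha (iota 0 N)) & v = seq_fact l.
Proof.
move=> a0 [cdv [lv [M [vM [[us [usv wus]] [k [wk sk]]]]]]].
(* The set for [v i] consists of the letters of a reduced cyclically decreasing word of it. *)
have /choice[f fP] : forall i, exists A,
    [/\ proper_of_size (alpha i) A, inw (v i) (wd A) & reduced (wd A)].
  move=> i; have [u [vu [ru cu]]] := cdv i.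
  have pT := cdw_proper n_gt2 cu.
  have W : weq (wd [set j in u]) u by apply: weq_wd => // j; rewrite inE.
  have su : size (wd [set j in u]) = size u.
    rewrite size_wd // cardsE; apply/card_uniqP; move: cu; rewrite cyc_dec_wordE // => /andP[] //.
  exists [set j in u]; split.
  - by rewrite /proper_of_size pT -size_wd // su (length_is_size (lv i) vu ru) eqxx.
  - exact: inw_weq vu (weq_sym W).
  by move=> z wz; rewrite su; apply: ru; exact: weq_trans (weq_sym W) wz.
have nilN i : N <= i -> wd (f i) = [::].
  move=> Ni; have [/andP[pi /eqP si] _ _] := fP i; apply: size0nil.
  by rewrite size_wd // si a0.
have nilM i : M <= i -> wd (f i) = [::].
  move=> Mi; have [/andP[pi /eqP si] _ _] := fP i; apply: size0nil.
  by rewrite size_wd // si; apply: length_is_one; rewrite -(vM i Mi).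
exists (mkseq f N); last first.
  apply: funext => i; rewrite /seq_fact; case: (ltnP i N) => iN.
    by rewrite nth_mkseq //; apply: cls_eq; have [] := fP i.
  rewrite nth_default ?size_mkseq // wd_set0 //; apply: cls_eq.
  by have [_ + _] := fP i; rewrite nilN.
rewrite mem_fact_list; apply/andP; split.
  apply/all2_map_iota; rewrite size_mkseq; split=> // i iN.
  by rewrite nth_mkseq //; have [] := fP i.
have -> : flatten (map (@wd n) (mkseq f N)) = flatten [seq wd (f i) | i <- iota 0 M].
  by rewrite -map_comp; exact: flatten_iota_nil.
have wf : inw w (flatten [seq wd (f i) | i <- iota 0 M]).
  apply: inw_weq wus _; elim: (iota 0 M) => [|i s IH] /=; first exact: weq_refl.
  by apply: weq_cat IH; have [_ vf _] := fP i; exact: inw_inw (usv i) vf.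
(* The concatenation is reduced because the lengths of the factors add up to that of [w]. *)
apply/asboolP; split=> // z wz; rewrite size_flatten_iota.
have -> : \sum_(i < M) size (wd (f i)) = k.
  by rewrite -sk; apply: eq_bigr => i _; have [/andP[pi /eqP si] _ _] := fP i; rewrite size_wd.
have [u [wu [ru <-]]] := wk; apply: ru.
exact: inw_inw wu (inw_weq wf wz).
Qed.

Lemma seq_fact_inj l l' N : size l = N -> size l' = N ->
  (forall i, i < N -> nth set0 l i != setT) -> (forall i, i < N -> nth set0 l' i != setT) ->
  seq_fact l = seq_fact l' -> l = l'.
Proof.
move=> sl sl' pl pl' e; apply: (@eq_from_nth _ set0); first by rewrite sl.
rewrite sl => i iN; apply: (wd_inj n_gt2); [exact: pl | exact: pl' |].
by apply: cls_weq; have := congr1 (fun v : nat -> affS n => v i) e.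
Qed.

Lemma In_map (T : eqType) (U : Type) (f : T -> U) (s : seq T) y :
  List.In y (map f s) <-> exists2 x, x \in s & y = f x.
Proof.
elim: s => [|x s IH] /=; first by split=> // -[].
rewrite IH; split=> [[<-|[z zs ->]]|[z]].
- by exists x; rewrite ?mem_head.
- by exists z; rewrite // inE zs orbT.
by rewrite inE => /orP[/eqP-> ->|zs ->]; [left | right; exists z].
Qed.

Lemma NoDup_map (T : eqType) (U : Type) (f : T -> U) (s : seq T) :
  uniq s -> {in s &, injective f} -> List.NoDup (map f s).
Proof.
elim: s => [|x s IH] /=; first by constructor.
case/andP=> xs us finj; constructor.
  move=> /In_map[z zs e]; have xz : x = z by apply: finj; rewrite ?mem_head // inE zs orbT.
  by rewrite xz zs in xs.
by apply: IH => // y z ys zs; apply: finj; rewrite inE ?ys ?zs orbT.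
Qed.

Lemma card_is_fun (T : Type) (S : T -> Prop) c c' : card_is S c -> card_is S c' -> c = c'.
Proof.
move=> [l [nl [<- Sl]]] [l' [nl' [<- Sl']]].
apply/eqP; rewrite eqn_leq; apply/andP; split; apply/leP; apply: List.NoDup_incl_length => // x.
  by move=> /Sl/Sl'.
by move=> /Sl'/Sl.
Qed.

(** [seq_fact] is a bijection from the listed sequences of subsets to the factorizations; it is
    injective because d_A determines A. *)
Lemma Ftilde_coeff_cnt alpha N : (forall i, N <= i -> alpha i = 0) ->
  Ftilde_coeff w alpha (cnt reduced_word_of (map alpha (iota 0 N))).
Proof.
move=> a0; exists (map seq_fact (fact_list reduced_word_of (map alpha (iota 0 N)))).
split; [|split].
- apply: NoDup_map; first exact: fact_list_uniq.
  move=> l l'; rewrite !mem_fact_list => /andP[/all2_map_iota[sl lP] _] /andP[/all2_map_iota[sl' lP'] _].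
  by apply: (seq_fact_inj sl sl') => i iN; [have /andP[] := lP i iN | have /andP[] := lP' i iN].
- by rewrite size_map.
move=> v; rewrite In_map; split=> [|[l lf ->]]; first exact: factorization_seq_fact.
exact: seq_fact_factorization lf.
Qed.

Lemma factorization_support alpha (v : nat -> affS n) : factorization w alpha v ->
  exists2 N, (forall i, N <= i -> alpha i = 0) & length_is w (\sum_(i < N) alpha i).
Proof.
move=> [_ [lv [N [vN [_ [k [wk sk]]]]]]]; exists N; last by rewrite sk.
by move=> i /vN vi; apply: length_is_one; rewrite -vi.
Qed.

Lemma Ftilde_coeff0 alpha : ~ (exists N, forall i, N <= i -> alpha i = 0) ->
  Ftilde_coeff w alpha 0.
Proof.
move=> nN; exists [::]; split; [by constructor | split=> // v].
by split=> // /factorization_support[N aN _]; case: nN; exists N.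
Qed.

Lemma Ftilde_coeff_exists alpha : exists! c, Ftilde_coeff w alpha c.
Proof.
suff [c Fc] : exists c, Ftilde_coeff w alpha c by exists c; split=> // c'; exact: card_is_fun.
have [[N aN]|nN] := pselect (exists N, forall i, N <= i -> alpha i = 0).
  by eexists; exact: Ftilde_coeff_cnt aN.
by exists 0; exact: Ftilde_coeff0.
Qed.

Lemma Ftilde_coeff_perm sigma alpha c : bijective sigma ->
  Ftilde_coeff w alpha c -> Ftilde_coeff w (fun i => alpha (sigma i)) c.
Proof.
move=> [tau sK tK] Fc.
(* If [s i] were below [N], then [i], which is [t (s i)], would be below the maximum. *)
have supp (s t : nat -> nat) N (a : nat -> nat) : cancel s t -> (forall i, N <= i -> a i = 0) ->
    forall i, \max_(j < N) (t j).+1 <= i -> a (s i) = 0.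
  move=> st aN i Ni; apply: aN; rewrite leqNgt; apply/negP => siN.
  have := leq_trans (leq_bigmax (Ordinal siN)) Ni; by rewrite /= st ltnn.
have [[N aN]|nN] := pselect (exists N, forall i, N <= i -> alpha i = 0); last first.
  rewrite (card_is_fun Fc (Ftilde_coeff0 nN)); apply: Ftilde_coeff0 => -[N aN].
  apply: nN; exists (\max_(j < N) (sigma j).+1) => i Ni.
  by have := supp _ _ _ _ tK aN i Ni; rewrite tK.
have aN' := supp _ _ _ _ sK aN.
rewrite (card_is_fun Fc (Ftilde_coeff_cnt aN)).
have := Ftilde_coeff_cnt aN'; congr card_is.
(* Once zeros are dropped, the exponent lists are permutations of each other: [sigma] maps the
   support of the permuted exponents bijectively onto that of [alpha]. *)
rewrite cnt_nonzero // [RHS]cnt_nonzero //; apply: cnt_perm => //; first exact: reduced_word_of_pred.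
rewrite !filter_map /= (map_comp alpha sigma); apply: perm_map; apply: uniq_perm.
- by rewrite map_inj_uniq ?filter_uniq ?iota_uniq //; exact: can_inj sK.
- by rewrite filter_uniq ?iota_uniq.
move=> j; rewrite mem_filter mem_iota /= add0n.
apply/mapP/andP => [[i]|[aj jN]].
  rewrite mem_filter /= => /andP[ai _] ->; split=> //.
  by rewrite ltnNge; apply: contraNN ai => /aN ->.
exists (tau j); rewrite ?tK // mem_filter mem_iota /= tK aj add0n.
by rewrite ltnNge; apply: contraNN aj => /aN'; rewrite tK => ->.
Qed.
End Factorizations.

Theorem theorem3p2 (n : nat) (w : affS n) :
  2 < n -> is_symmetric_function (Ftilde_coeff w).
Proof.
move=> n_gt2; split; [|split].
- exact: Ftilde_coeff_exists.
(* The series is homogeneous of degree the length of [w]. *)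
- have [d wd] := length_isE w; exists d => alpha c [l [_ [<- Fl]]].
  case: l Fl => // v l Fl _.
  have /factorization_support[N aN wN] : factorization w alpha v by apply/Fl; left.
  by exists N; split=> //; rewrite (length_is_fun wN wd).
move=> sigma bij alpha c; exact: Ftilde_coeff_perm.
Qed.
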